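(* Let $\lambda,\lambda_s,\mu>0$ with $\lambda+\lambda_s<\mu$, and let $\pi=(\pi_0,\pi_1,\ldots)$ be given by $\pi_0=1-\rho$, $\pi_k=\rho(1-\sigma)\sigma^{k-1}$ for $k\ge1$, where $\rho=(\lambda+\lambda_s)/\mu$ and $\sigma=\lambda/\mu$. Let $u(t,u(0))$ denote the state at time $t$ of the limiting (mean field) system started from $u(0)$. Then $$\lim_{t\to\infty}u(t,u(0))=\pi\quad\text{for any initial state }u(0),$$ i.e. the fixed point $\pi$ of the limiting system is globally asymptotically stable.
   Context: Finite $N$ model: $N$ parallel queues, each with infinite waiting space and one server with exponential service rate $\mu$. Each queue has its own dedicated Poisson arrival stream of rate $\lambda$; an additional Poisson stream of rate $N\lambda_s$ brings customers who each join a shortest queue. All streams and services are independent. $X_i^N(t)$ is the length of queue $i$ at time $t$, and $U^N_k(t)=\frac1N\#\{i: X^N_i(t)=k\}$, $k\ge0$. Then $U^N(t)=(U^N_0(t),U^N_1(t),\ldots)$ is a continuous-time Markov process. Limiting (mean field) system: initial states are vectors $u(0)=(u_0(0),u_1(0),\ldots)$ with $u_k(0)\ge0$ and $\sum_{k\ge0}u_k(0)=1$. The deterministic trajectory $t\mapsto u(t)=u(t,u(0))=(u_0(t),u_1(t),\ldots)$ is the limit, in the sense of weak convergence of processes as $N\to\infty$, of $U^N(\cdot)$ started from initial states $U^N(0)\to u(0)$. At times when $u_0(t)>0$ it satisfies $$\dot u_0=-\lambda u_0-\lambda_s+\mu u_1,\qquad \dot u_1=\lambda u_0+\lambda_s-(\lambda+\mu)u_1+\mu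 u_2,\qquad \dot u_k=\lambda u_{k-1}-(\lambda+\mu)u_k+\mu u_{k+1}\ (k\ge2).$$ The number $u_k(t)$ is the probability that the ''typical queue'' has length $k$ at time $t$. Convergence of states is componentwise. The vector $\pi$ is a fixed point of the limiting system. *)

(* Defs.v *)
From HB Require Import structures.
From mathcomp Require Import all_boot all_order all_algebra.
From mathcomp Require Import all_classical all_reals all_analysis.

Set Implicit Arguments.
Unset Strict Implicit.
Unset Printing Implicit Defensive.
Import Order.TTheory GRing.Theory Num.Theory.
Import numFieldNormedType.Exports.

Local Open Scope classical_set_scope.
Local Open Scope ring_scope.

(* A path is a function on R of which only the restriction to [0, +oo[ is
   meaningful. *)

Definition is_state (R : realType) (u : nat -> R) : Prop :=
  (forall k, 0 <= u k) /\ (\sum_(k < n) u k) @[n --> \oo] --> (1 : R).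

Definition occupancy (R : realType) (N : nat) (x : 'I_N -> nat) : nat -> R :=
  fun k => #|[set i | x i == k]%SET|%:R / N%:R.

Definition step_path (R : realType) (f : R -> nat) : Prop :=
  (forall t : R, 0 <= t -> \forall s \near t^'+, f s = f t) /\
  (forall t : R, 0 < t -> exists a, \forall s \near t^'-, f s = a).

Definition counting_path (R : realType) (f : R -> nat) : Prop :=
  [/\ f 0 = 0%N, step_path f &
      forall s t : R, 0 <= s -> s <= t -> (f s <= f t)%N].

(* N parallel queues.  A i : dedicated arrivals to queue i, rate lambda.
   S i : service completions of server i, rate mu; a completion occurring while
   the queue is empty is void (memorylessness of the exponential law).
   G : stream of customers who join a shortest queue, rate N * lambda_s.
   The streams are independent Poisson processes relative to the filtration F,
   to which the queue lengths X are adapted; the choice among several shortest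
   queues is any one that does not anticipate the future. *)
Record driven_queues (R : realType) (lambda lambda_s mu : R) (N : nat)
    (d : measure_display) (T : measurableType d) (P : probability T R)
    (F : R -> set (set T)) (A S : 'I_N -> R -> T -> nat) (G : R -> T -> nat)
    (X : R -> T -> 'I_N -> nat) : Prop := DrivenQueues {
  filtration_sigma_algebra : forall t : R, 0 <= t ->
    sigma_algebra setT (F t) /\ F t `<=` measurable;
  filtration_nondecreasing : forall s t : R, 0 <= s -> s <= t -> F s `<=` F t;
  streams_adapted : forall t : R, 0 <= t -> forall n,
    (forall i, F t [set w | A i t w = n]) /\
    (forall i, F t [set w | S i t w = n]) /\ F t [set w | G t w = n];
  streams_counting : forall w,
    (forall i, counting_path (A i ^~ w)) /\
    (forall i, counting_path (S i ^~ w)) /\ counting_path (G ^~ w);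
  streams_poisson : forall s t : R, 0 <= s -> s < t ->
    forall (B : set T) (a b : 'I_N -> nat) (g : nat), F s B ->
    P (B `&` [set w | [/\ forall i, (A i t w - A i s w)%N = a i,
                          forall i, (S i t w - S i s w)%N = b i &
                          (G t w - G s w)%N = g]]) =
    (P B * ((\prod_(i < N) poisson_pmf (lambda * (t - s)) (a i)) *
            (\prod_(i < N) poisson_pmf (mu * (t - s)) (b i)) *
            poisson_pmf (N%:R * lambda_s * (t - s)) g)%:E)%E;
  queues_adapted : forall t : R, 0 <= t -> forall i n,
    F t [set w | X t w i = n];
  queues_step : forall w i, step_path (fun t => X t w i);
  (* For s close to t on the left, every path has its value at t-, so the
     differences below are jumps at t.  The truncated subtraction makes service
     completions at an empty queue void. *)
  queues_jump : forall w (t : R), 0 < t -> \forall s \near t^'-,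
    exists2 j : 'I_N, (forall i, (X s w j <= X s w i)%N) &
      forall i, X t w i =
        ((X s w i - (S i t w - S i s w)) + (A i t w - A i s w)
         + (i == j) * (G t w - G s w))%N }.

Definition jsq_system (R : realType) (lambda lambda_s mu : R) (N : nat)
    (d : measure_display) (T : measurableType d) (P : probability T R)
    (X : R -> T -> 'I_N -> nat) : Prop :=
  exists F A S G, driven_queues lambda lambda_s mu P F A S G X.

(* The Skorokhod space D([0, +oo[, E), for E the set of states with the topology
   of componentwise convergence; note that left limits are taken within E. *)
Definition cadlag (R : realType) (x : R -> nat -> R) : Prop :=
  [/\ forall t : R, 0 <= t -> is_state (x t),
      forall t : R, 0 <= t -> forall k, x s k @[s --> t^'+] --> x t k &
      forall t : R, 0 < t -> exists2 l, is_state l &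
        forall k, x s k @[s --> t^'-] --> l k].

Definition time_change (R : realType) (tau : R -> R) : Prop :=
  set_bij [set t | 0 <= t] [set t | 0 <= t] tau /\
  forall s t : R, 0 <= s -> s < t -> tau s < tau t.

(* Sequential convergence in the J1 topology of D([0, +oo[, E). *)
Definition skorokhod_cvg (R : realType) (x : nat -> R -> nat -> R)
    (y : R -> nat -> R) : Prop :=
  exists2 tau : nat -> R -> R, forall n, time_change (tau n) &
    forall c e : R, 0 < e ->
      (\forall n \near \oo, forall t : R, 0 <= t -> t <= c ->
         `|tau n t - t| < e) /\
      (forall k, \forall n \near \oo, forall t : R, 0 <= t -> t <= c ->
         `|x n t k - y (tau n t) k| < e).

(* As the J1 topology is metrizable, continuity is sequential continuity. *)
Definition bounded_skorokhod_continuous (R : realType)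
    (Phi : (R -> nat -> R) -> R) : Prop :=
  (exists M, forall x, cadlag x -> `|Phi x| <= M) /\
  (forall x y, (forall n, cadlag (x n)) -> cadlag y -> skorokhod_cvg x y ->
     Phi (x n) @[n --> \oo] --> Phi y).

(* Weak convergence, on the Skorokhod space, of the laws of the processes U n
   to the point mass at the path u. *)
Definition weak_cvg_to_path (R : realType) (d : nat -> measure_display)
    (T : forall n, measurableType (d n)) (P : forall n, probability (T n) R)
    (U : forall n, R -> T n -> nat -> R) (u : R -> nat -> R) : Prop :=
  cadlag u /\
  forall Phi, bounded_skorokhod_continuous Phi ->
    'E_(P n)[fun w => Phi (fun t => U n t w)]%E @[n --> \oo] --> (Phi u)%:E.

(* u is the trajectory u(., u0) of the limiting system.  The n-th system of the
   sequence has n.+1 queues. *)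
Definition mean_field_trajectory (R : realType) (lambda lambda_s mu : R)
    (u0 : nat -> R) (u : R -> nat -> R) : Prop :=
  exists (d : nat -> measure_display) (T : forall n, measurableType (d n))
    (P : forall n, probability (T n) R)
    (X : forall n, R -> T n -> 'I_n.+1 -> nat) (v : nat -> nat -> R),
  [/\ forall n, jsq_system lambda lambda_s mu (P n) (X n),
      forall n w, occupancy R (X n 0 w) = v n,
      forall k, v n k @[n --> \oo] --> u0 k &
      weak_cvg_to_path P (fun n t w => occupancy R (X n t w)) u].

Definition fixed_point (R : realType) (lambda lambda_s mu : R) (k : nat) : R :=
  let rho := (lambda + lambda_s) / mu in
  let sigma := lambda / mu in
  if k is k'.+1 then rho * (1 - sigma) * sigma ^+ k' else 1 - rho.

(* Main.v *)
Require Import Defs.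
From HB Require Import structures.
From mathcomp Require Import all_boot all_order all_algebra.
From mathcomp Require Import all_classical all_reals all_analysis.
From mathcomp Require Import measurable_realfun ring lra zify.
Import Order.TTheory GRing.Theory Num.Theory.
Import numFieldNormedType.Exports.
Local Open Scope classical_set_scope.
Local Open Scope ring_scope.
Set Implicit Arguments.
Unset Strict Implicit.
Unset Printing Implicit Defensive.

(** Write s_k(t) for the proportion of queues of length at least k in the
limiting system, and pi_k = rho * sigma ^ (k - 1) for its value at the fixed
point. Since u_k = s_k - s_{k+1}, it suffices that every s_k(t) tends to pi_k.

The limiting equations are never solved, nor is their behaviour at times
without empty queues determined. Without shared customers the tails would obey
  s_k' = lambda (s_{k-1} - s_k) - mu (s_k - s_{k+1}),
and all that is used about shared customers is that they increase each s_k,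
increase the sum of the s_k at rate at most lambda_s, and all go to s_1 while
s_1 < 1. The record [tail_dynamics] states this in Euler form, for a time step
h with an error O(h^2), so that neither derivatives nor integrals occur.

These three properties give two Lyapunov functions,
  sum_k (s_k - pi_k - eps)^+  and  sum_k (pi_k - s_k)^+.
The first is finite even if the mean initial length is infinite, because s_k
tends to 0; this is what the eps is for. For either sum the nearest-neighbour
flow telescopes and leaves a loss at rate at least mu times the first term. A
shared customer who joins a queue of length k - 1 with k > 1 does so when
s_1 = 1; then s_1 exceeds its fixed value, and the customer missing at level 1
compensates the one added at level k. Hence the first term is integrable in
time, and being Lipschitz it tends to 0 ([eventually_lt_of_dissipation]). So
s_1 tends to rho; in particular the queues do not all stay busy, and the Euler
form of the equation for s_k gives the limit of s_{k+1} from those of s_k and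
s_{k-1} ([tail_cvg]).

The properties of s come from the systems with N queues. As the limit is
deterministic and the proportions are bounded, expectations suffice, and no
martingale or concentration estimate is needed. In a step of length h, for
fixed N, two ticks of the driving Poisson processes have probability O(h^2),
and a single one acts on the queues in a known way and is independent of the
past ([one_step_mean]); adding up steps and letting h tend to 0 bounds the
growth of expectations over any interval ([queue_avg_growth]).

Weak convergence is used through a single family of functionals: the largest
value that a tent function around the point (t0, a) takes on the graph of the
k-th coordinate of a path ([graph_bump]). It is continuous for the Skorokhod topology at every path,
although evaluation at t0 is not. For a = u_k(t0) its expectation tends to 1,
so the graph of the k-th proportion passes close to (t0, u_k(t0)) with high
probability, and the proportion cannot move much within a short time since it
changes by at most the number of ticks divided by N. This gives convergence in
mean at every fixed time ([occupancy_cvg_mean]). *)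

(** * Euler inequalities *)

(** One-step bounds accumulate over [t, t + h]: with m steps of length h / m the
quadratic errors add up to K h^2 / m, which vanishes as m grows. *)
Lemma euler_le (R : realType) (phi : R -> R) (t h B K d0 : R) :
  0 <= h -> 0 < d0 ->
  (forall r d, t <= r -> r + d <= t + h -> 0 < d -> d <= d0 ->
     phi (r + d) <= phi r + d * B + K * d ^+ 2) ->
  phi (t + h) <= phi t + h * B.
Proof.
move=> h0 d00 step; rewrite leNgt; apply/negP => gap.
have [hE|hpos] : h = 0 \/ 0 < h by move: h0; rewrite le_eqVlt => /orP[/eqP|]; auto.
  by move: gap; rewrite hE addr0; lra.
set g := phi (t + h) - (phi t + h * B).
have g0 : 0 < g by rewrite /g; lra.
have hm1 := archi_boundP (divr_ge0 h0 (ltW d00)).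
have K0 : 0 <= `|K| * h ^+ 2 / g by rewrite divr_ge0 ?(ltW g0)// mulr_ge0 ?sqr_ge0.
have hm2 := archi_boundP K0.
set m1 := Num.bound _ in hm1; set m2 := Num.bound _ in hm2.
pose m := (maxn m1 m2).+1.
have m0 : 0 < m%:R :> R by rewrite ltr0n.
have hm1' : h / d0 < m%:R.
  by apply: lt_le_trans hm1 _; rewrite ler_nat /m leqW// leq_maxl.
have hm2' : `|K| * h ^+ 2 / g < m%:R.
  by apply: lt_le_trans hm2 _; rewrite ler_nat /m leqW// leq_maxr.
pose d := h / m%:R.
have dpos : 0 < d by rewrite /d divr_gt0.
have dd0 : d <= d0.
  by rewrite /d ler_pdivrMr// mulrC -ler_pdivrMr// ltW.
have md : m%:R * d = h by rewrite /d mulrC divfK// gt_eqF.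
have key j : (j <= m)%N ->
    phi (t + j%:R * d) <= phi t + j%:R * (d * B + K * d ^+ 2).
  elim: j => [|j IH] jm; first by rewrite !mul0r !addr0.
  have -> : t + j.+1%:R * d = (t + j%:R * d) + d by rewrite -natr1; ring.
  apply: le_trans (step _ _ _ _ dpos dd0) _.
  - by rewrite lerDl mulr_ge0// ltW.
  - rewrite -addrA lerD2l -[leRHS]md -[X in _ + X]mul1r -mulrDl natr1.
    by rewrite ler_wpM2r ?ler_nat// ltW.
  - by have := IH (ltnW jm); rewrite -natr1; lra.
have := key m (leqnn m); rewrite md mulrDr mulrA md => kk.
have : `|K| * h ^+ 2 < m%:R * g by rewrite -ltr_pdivrMr.
have -> : m%:R * g = m%:R * (phi (t + h) - (phi t + h * B)) by [].
have gle : g <= m%:R * (K * d ^+ 2) by rewrite /g; lra.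
have e1 : m%:R * (m%:R * (K * d ^+ 2)) = K * h ^+ 2 by rewrite -md; ring.
have : m%:R * g <= `|K| * h ^+ 2.
  apply: le_trans (ler_wpM2l (ltW m0) gle) _.
  by rewrite e1 ler_wpM2r ?sqr_ge0// ler_norm.
by rewrite -/g; lra.
Qed.

(** * Dissipation of sums of positive parts *)

Definition pos_part (R : realType) (x : R) : R := Num.max x 0.

Section Pos.
Context {R : realType}.
Implicit Types x y : R.
Lemma pos_part_ge0 x : 0 <= pos_part x. Proof. by rewrite /pos_part le_max lexx orbT. Qed.
Lemma le_pos_part x : x <= pos_part x. Proof. by rewrite /pos_part le_max lexx. Qed.
Lemma pos_part_le x y : x <= y -> 0 <= y -> pos_part x <= y.
Proof. by move=> xy y0; rewrite /pos_part ge_max xy. Qed.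
Lemma pos_part_id x : 0 <= x -> pos_part x = x. Proof. by move=> /max_idPl. Qed.
Lemma pos_part_eq0 x : x <= 0 -> pos_part x = 0. Proof. by move=> /max_idPr. Qed.
End Pos.

Definition excess (R : realType) (z : nat -> R -> R) (n : nat) (t : R) : R :=
  \sum_(k < n) pos_part (z k.+1 t).

Lemma excess_mono (R : realType) (z : nat -> R -> R) t m n :
  (m <= n)%N -> excess z m t <= excess z n t.
Proof.
move=> mn; rewrite -(subnKC mn) /excess big_split_ord /= lerDl.
by apply: sumr_ge0 => i _; exact: pos_part_ge0.
Qed.

(** The functional [V t], the supremum of the partial sums [excess z n t], does not
increase, and decreases by a fixed amount [kap] on a short interval after each
time at which [z 1] reaches [d], since [z 1] is Lipschitz. This is impossible
once [V] is within [kap] of its infimum. *)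
Lemma eventually_lt_of_dissipation (R : realType) (mu : R) (z : nat -> R -> R) (L th : R) :
  0 < mu -> 0 < L -> 0 < th ->
  (forall n, exists C d0, 0 < d0 /\ forall t h, 0 <= t -> 0 < h -> h <= d0 ->
    excess z n (t + h) <= excess z n t - mu * h * pos_part (z 1 t)
      + mu * h * pos_part (z n.+1 t) + C * h ^+ 2) ->
  (forall t e, 0 <= t -> 0 < e -> exists n0, forall n r,
    (n0 <= n)%N -> t <= r -> r <= t + th -> pos_part (z n r) <= e) ->
  (forall t, 0 <= t -> exists M, forall n, excess z n t <= M) ->
  (forall t h, 0 <= t -> 0 <= h -> `|z 1 (t + h) - z 1 t| <= L * h) ->
  forall d, 0 < d -> exists2 T, 0 <= T & forall t, T <= t -> z 1 t < d.
Proof.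
move=> mu0 L0 th0 step tail_of bdd lip d d0.
pose S t := [set excess z n t | n in [set: nat]].
pose V t := sup (S t).
have supS t : 0 <= t -> has_sup (S t).
  move=> t0; split; first by exists (excess z 0 t); exists 0.
  by have [M hM] := bdd t t0; exists M => _ [n _ <-].
have leV t n : 0 <= t -> excess z n t <= V t.
  by move=> t0; apply: sup_upper_bound; [exact: supS|exists n].
have V0 t : 0 <= t -> 0 <= V t.
  by move=> t0; apply: le_trans (leV t 0 t0); rewrite /excess big_ord0.
have Vstep t h B : 0 <= t -> 0 <= h -> h <= th -> 0 <= B ->
    (forall r, t <= r -> r <= t + h -> B <= pos_part (z 1 r)) ->
    V (t + h) <= V t - mu * h * B.
  move=> t0 h0 hth B0 hB; apply/ler_addgt0Pr => e e0.
  have [hE|hpos] : h = 0 \/ 0 < h by move: h0; rewrite le_eqVlt => /orP[/eqP|]; auto.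
    by rewrite hE addr0; lra.
  apply: ge_sup; first by exists (excess z 0 (t + h)); exists 0.
  move=> _ [n' _ <-].
  have mh0 : 0 < mu * h by rewrite mulr_gt0.
  have [n0 hn0] := tail_of t (e / (mu * h)) t0 (divr_gt0 e0 mh0).
  pose n := maxn n' n0.
  apply: le_trans (excess_mono z (t + h) (leq_maxl n' n0)) _.
  have [C [dd [dd0 st]]] := step n.
  apply: le_trans (@euler_le _ (excess z n) t h (- (mu * B) + e / h) C dd h0 dd0 _) _.
    move=> r q tr rq q0 qd.
    apply: le_trans (st r q (le_trans t0 tr) q0 qd) _.
    have rth : r <= t + h by lra.
    have := hB r tr rth => HB.
    have rth' : r <= t + th by lra.
    have := hn0 n.+1 r (leq_trans (leq_maxr n' n0) (leqnSn _)) tr rth' => HE.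
    have a1 : mu * q * B <= mu * q * pos_part (z 1 r).
      by rewrite ler_wpM2l// mulr_ge0// ltW.
    have a2 : mu * q * pos_part (z n.+1 r) <= mu * q * (e / (mu * h)).
      by rewrite ler_wpM2l// mulr_ge0// ltW.
    have a3 : mu * q * (e / (mu * h)) = q * (e / h).
      by field; rewrite !gt_eqF.
    by lra.
  have := leV t n t0.
  have -> : h * (- (mu * B) + e / h) = - (mu * h * B) + e by field; rewrite gt_eqF.
  lra.
have Vmono t h : 0 <= t -> 0 <= h -> V (t + h) <= V t.
  move=> t0 h0.
  have := @euler_le _ V t h 0 0 th h0 th0; rewrite mulr0 addr0; apply.
  move=> r q tr _ q0 qth; rewrite mulr0 mul0r !addr0.
  have := Vstep r q 0 (le_trans t0 tr) (ltW q0) qth (lexx 0).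
  by rewrite mulr0 subr0; apply => *; exact: pos_part_ge0.
pose W := [set V t | t in [set t | 0 <= t]].
have hinf : has_inf W.
  split; first by exists (V 0); exists 0 => //=.
  by exists 0 => _ [t t0 <-]; exact: V0.
pose h := Num.min th (d / (2 * L)).
have h0 : 0 < h by rewrite /h lt_min th0 divr_gt0// mulr_gt0.
have hth : h <= th by rewrite /h ge_min lexx.
have hL : L * h <= d / 2.
  apply: (@le_trans _ _ (L * (d / (2 * L)))).
    by rewrite ler_wpM2l ?(ltW L0)// /h ge_min lexx orbT.
  by rewrite le_eqVlt; apply/orP; left; apply/eqP; field; rewrite gt_eqF.
pose kap := mu * h * (d / 2).
have kap0 : 0 < kap by rewrite /kap !mulr_gt0// invr_gt0.
have [_ [T T0 <-] VT] := inf_adherent kap0 hinf.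
exists T => // t Tt; rewrite ltNge; apply/negP => zd.
have t0 : 0 <= t by exact: le_trans Tt.
have : V (t + h) <= V t - kap.
  apply: Vstep => //; [exact: ltW|by rewrite divr_ge0// ltW|].
  move=> r tr rth; apply: le_trans (le_pos_part _).
  have := lip t (r - t) t0; rewrite subr_ge0 => /(_ tr).
  have -> : t + (r - t) = r by ring.
  have : L * (r - t) <= L * h by rewrite ler_wpM2l ?(ltW L0)//; lra.
  rewrite ler_norml => + /andP[]; lra.
have := Vmono T (t - T) T0; rewrite subr_ge0 => /(_ Tt).
have -> : T + (t - T) = t by ring.
have : inf W <= V (t + h).
  apply: ge_inf; first by case: hinf.
  by exists (t + h) => //=; rewrite addr_ge0// ltW.
lra.
Qed.

(** * Convergence of the limiting system *)

(** The data of a mean field trajectory that determine its limit. The first two terms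
in each drift are the effect of dedicated arrivals and of services; the three
bounds locate the shared arrivals: never negative at a level, at most [lams] in
total, and all at level 1 if a proportion [eta] of the queues is empty. The
constant in the last bound depends on [eta] because queues that fill up during
the step must not exhaust the empty ones. *)
Record tail_dynamics (R : realType) (lam lams mu : R) (s : nat -> R -> R) : Prop :=
  TailDynamics {
  tail0 : forall t, 0 <= t -> s 0%N t = 1;
  tail_ge0 : forall k t, 0 <= t -> 0 <= s k t;
  tail_noninc : forall k t, 0 <= t -> s k.+1 t <= s k t;
  tail_cvg0 : forall t, 0 <= t -> forall e, 0 < e ->
    exists n0, forall n, (n0 <= n)%N -> s n t <= e;
  tail_lipschitz : exists2 L, 0 < L & forall k t h, 0 <= t -> 0 <= h ->
    `|s k (t + h) - s k t| <= L * h;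
  tail_drift_ge : exists2 C, 0 <= C & forall k t h, 0 <= t -> 0 <= h ->
    h * (lam * (s k t - s k.+1 t) - mu * (s k.+1 t - s k.+2 t)) - C * h ^+ 2
    <= s k.+1 (t + h) - s k.+1 t;
  tail_drift_sum : forall n, exists2 C, 0 <= C & forall t h, 0 <= t -> 0 <= h ->
    \sum_(k < n) (s k.+1 (t + h) - s k.+1 t) <=
    h * (lam * (1 - s n t) - mu * (s 1%N t - s n.+1 t) + lams) + C * h ^+ 2;
  tail_drift1_ge : forall eta, 0 < eta -> exists2 C, 0 <= C &
    forall t h, 0 <= t -> 0 <= h -> s 1%N t <= 1 - eta ->
    h * (lam * (1 - s 1%N t) - mu * (s 1%N t - s 2%N t) + lams) - C * h ^+ 2
    <= s 1%N (t + h) - s 1%N t }.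

Lemma sum_flux (R : realType) (a b : R) (p : nat -> R) (n : nat) :
  \sum_(k < n) (a * (p k - p k.+1) - b * (p k.+1 - p k.+2)) =
  a * (p 0%N - p n) - b * (p 1%N - p n.+1).
Proof.
elim: n => [|n IH]; first by rewrite big_ord0; ring.
by rewrite big_ord_recr /= IH; ring.
Qed.

(** The positive parts satisfy the linear recursion of the tails with defects [g k].
Its sum telescopes to an outflow at level 1 and an inflow at level n + 1. *)
Lemma excess_step (R : realType) (lam mu h K : R) (z : nat -> R -> R)
    (g : nat -> R) (n : nat) (t : R) :
  0 <= lam -> 0 <= mu -> 0 <= h -> h * (lam + mu) <= 1 -> z 0%N t <= 0 ->
  (forall k, (k < n)%N -> pos_part (z k.+1 (t + h)) <=
     pos_part (z k.+1 t) + h * (lam * (pos_part (z k t) - pos_part (z k.+1 t))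
       - mu * (pos_part (z k.+1 t) - pos_part (z k.+2 t))) + g k) ->
  \sum_(k < n) g k <= K ->
  excess z n (t + h) <= excess z n t - mu * h * pos_part (z 1%N t)
      + mu * h * pos_part (z n.+1 t) + K.
Proof.
move=> l0 m0 h0 hh z0 zk gK; rewrite /excess.
apply: (@le_trans _ _ (\sum_(k < n) (pos_part (z k.+1 t) +
   h * (lam * (pos_part (z k t) - pos_part (z k.+1 t))
       - mu * (pos_part (z k.+1 t) - pos_part (z k.+2 t))) + g k))).
  by apply: ler_sum => k _; exact: zk.
rewrite big_split big_split /= -mulr_sumr (sum_flux lam mu (fun k => pos_part (z k t))).
rewrite (pos_part_eq0 z0).
have : 0 <= h * (lam * pos_part (z n t)) by rewrite !mulr_ge0// pos_part_ge0.
lra.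
Qed.

(** For [h * (lam + mu) <= 1] an explicit Euler step has nonnegative coefficients, so
it commutes with taking positive parts up to an inequality. *)
Lemma convex_step (R : realType) (lam mu h x0 x1 x2 : R) :
  0 <= lam -> 0 <= mu -> 0 <= h -> h * (lam + mu) <= 1 ->
  x1 + h * (lam * (x0 - x1) - mu * (x1 - x2)) <=
    pos_part x1 + h * (lam * (pos_part x0 - pos_part x1) - mu * (pos_part x1 - pos_part x2))
  /\ 0 <= pos_part x1 + h * (lam * (pos_part x0 - pos_part x1) - mu * (pos_part x1 - pos_part x2)).
Proof.
move=> l0 m0 h0 hh.
have a1 : 0 <= (1 - h * (lam + mu)) * (pos_part x1 - x1).
  by rewrite mulr_ge0// subr_ge0 ?le_pos_part.
have a2 : 0 <= h * lam * (pos_part x0 - x0).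
  by rewrite !mulr_ge0// subr_ge0 ?le_pos_part.
have a3 : 0 <= h * mu * (pos_part x2 - x2).
  by rewrite !mulr_ge0// subr_ge0 ?le_pos_part.
have b1 : 0 <= (1 - h * (lam + mu)) * pos_part x1.
  by rewrite mulr_ge0 ?pos_part_ge0// subr_ge0.
have b2 : 0 <= h * lam * pos_part x0 by rewrite !mulr_ge0// ?pos_part_ge0.
have b3 : 0 <= h * mu * pos_part x2 by rewrite !mulr_ge0// ?pos_part_ge0.
by split; lra.
Qed.

Section TailDynamics.
Context {R : realType} (lam lams mu : R) (s : nat -> R -> R).
Hypothesis lam0 : 0 < lam.
Hypothesis lams0 : 0 < lams.
Hypothesis mu0 : 0 < mu.
Hypothesis stable : lam + lams < mu.
Hypothesis dyn : tail_dynamics lam lams mu s.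

Let rho := (lam + lams) / mu.
Let sigma := lam / mu.
Definition tail_fixed (k : nat) : R := if k is k'.+1 then rho * sigma ^+ k' else 1.
Local Notation p := tail_fixed.

Lemma rho_gt0 : 0 < rho. Proof. by rewrite divr_gt0// addr_gt0. Qed.
Lemma rho_lt1 : rho < 1. Proof. by rewrite ltr_pdivrMr// mul1r. Qed.
Lemma sigma_gt0 : 0 < sigma. Proof. by rewrite divr_gt0. Qed.
Lemma sigma_lt1 : sigma < 1.
Proof. by rewrite ltr_pdivrMr// mul1r; apply: lt_trans stable; rewrite ltrDl. Qed.

(** The tails of the fixed point are stationary for dedicated arrivals and services
except at level 1, which needs exactly the whole shared stream. *)
Lemma tail_fixed_drift k :
  lam * (p k - p k.+1) - mu * (p k.+1 - p k.+2) = - lams *+ (k == 0%N).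
Proof.
have rE : rho * mu = lam + lams by rewrite /rho divfK// gt_eqF.
have sE : sigma * mu = lam by rewrite /sigma divfK// gt_eqF.
case: k => [|k] /=.
  rewrite expr0 expr1 mulr1 mulr1n.
  have -> : mu * (rho - rho * sigma) = rho * mu - rho * (sigma * mu) by ring.
  by rewrite rE sE; ring.
rewrite mulr0n !exprS; have := sE => <-; ring.
Qed.

Lemma tail_fixed_ge0 k : 0 <= p k.
Proof.
case: k => //= k; rewrite mulr_ge0 ?(ltW rho_gt0)// exprn_ge0// ltW//.
exact: sigma_gt0.
Qed.

Lemma tail_fixed_cvg0 e : 0 < e -> exists n0, forall n, (n0 <= n)%N -> p n <= e.
Proof.
move=> e0.
have : (fun n => sigma ^+ n) @ \oo --> (0 : R).
  by apply: cvg_expr; rewrite ger0_norm ?sigma_lt1// ltW// sigma_gt0.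
move=> /cvgrPdist_le /(_ _ e0)[n0 _ hn0]; exists n0.+1 => -[//|n] n0n /=.
have := hn0 n n0n; rewrite /= sub0r normrN ger0_norm => [h|]; last first.
  by rewrite exprn_ge0// ltW// sigma_gt0.
apply: le_trans h; rewrite ler_piMl ?(ltW rho_lt1)//.
by rewrite exprn_ge0// ltW// sigma_gt0.
Qed.

Lemma tail_fixed_sum n : \sum_(k < n) p k.+1 <= rho / (1 - sigma).
Proof.
rewrite /= -mulr_sumr; apply: ler_wpM2l; first exact: ltW rho_gt0.
have s1 := sigma_lt1.
have : (1 - sigma) * (\sum_(i < n) sigma ^+ i) = 1 - sigma ^+ n.
  by rewrite -opprB mulNr -subrX1 opprB.
have : 0 <= sigma ^+ n by rewrite exprn_ge0// ltW// sigma_gt0.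
by rewrite -[_^-1]mul1r ler_pdivlMr ?subr_gt0// mulrC; lra.
Qed.

(* The contribution of the shared stream to level k + 1 during [t, t + h]. *)
Let D k t h := s k.+1 (t + h) - s k.+1 t
  - h * (lam * (s k t - s k.+1 t) - mu * (s k.+1 t - s k.+2 t)).

Lemma shared_ge : exists2 C, 0 <= C & forall k t h, 0 <= t -> 0 <= h ->
  - (C * h ^+ 2) <= D k t h.
Proof.
have [C C0 hC] := tail_drift_ge dyn; exists C => // k t h t0 h0.
by have := hC k t h t0 h0; rewrite /D; lra.
Qed.

Lemma shared_sum n : exists2 C, 0 <= C & forall t h, 0 <= t -> 0 <= h ->
  \sum_(k < n) D k t h <= h * lams + C * h ^+ 2.
Proof.
have [C C0 hC] := tail_drift_sum dyn n; exists C => // t h t0 h0.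
rewrite /D sumrB -mulr_sumr (sum_flux lam mu (s ^~ t)) (tail0 dyn t0).
by have := hC t h t0 h0; lra.
Qed.

Lemma shared1_ge eta : 0 < eta -> exists2 C, 0 <= C &
  forall t h, 0 <= t -> 0 <= h -> s 1%N t <= 1 - eta ->
  h * lams - C * h ^+ 2 <= D 0 t h.
Proof.
move=> /(tail_drift1_ge dyn)[C C0 hC]; exists C => // t h t0 h0 s1.
by have := hC t h t0 h0 s1; rewrite /D (tail0 dyn t0); lra.
Qed.

(** The contributions sum to at most [h * lams] and none is noticeably negative, so each
is at most that sum; when level 1 takes everything, nothing remains for the
others. *)
Lemma shared_le n eta : 0 < eta -> exists2 C, 0 <= C &
  forall k t h, (k < n)%N -> 0 <= t -> 0 <= h -> 
  ((k == 0%N) || (s 1%N t <= 1 - eta)) ->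
  D k t h <= h * lams *+ (k == 0%N) + C * h ^+ 2.
Proof.
move=> eta0.
have [C1 C10 h1] := shared_ge; have [C2 C20 h2] := shared_sum n.
have [C3 C30 h3] := shared1_ge eta0.
exists (C2 + C3 + n%:R * C1) => [|k t h kn t0 h0 ks].
  by rewrite !addr_ge0// mulr_ge0.
have hh : 0 <= h ^+ 2 by rewrite sqr_ge0.
have := h2 t h t0 h0.
rewrite (bigD1 (Ordinal kn)) //=.
have n0 : (0 < n)%N by apply: leq_ltn_trans kn.
have lowb (P : pred 'I_n) : - (n%:R * C1 * h ^+ 2) <= \sum_(i < n | P i) D i t h.
  apply: (@le_trans _ _ (\sum_(i < n | P i) - (C1 * h ^+ 2))).
    rewrite big_const -Monoid.iteropE -/(GRing.natmul _ _) mulNrn lerN2 -[leLHS]mulr_natl.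
    rewrite mulrA ler_wpM2r// ler_wpM2r// ler_nat.
    by apply: leq_trans (max_card _) _; rewrite card_ord.
  by apply: ler_sum => i _; exact: h1.
case: eqP ks => [k0 _|/eqP kn0 /= s1].
  have := lowb (fun i => i != Ordinal kn).
  have : 0 <= C3 * h ^+ 2 by rewrite mulr_ge0.
  by rewrite mulr1n; lra.
rewrite (bigD1 (Ordinal n0)) /=; last by rewrite -val_eqE /= eq_sym.
have := lowb (fun i => (i != Ordinal kn) && (i != Ordinal n0)).
by have := h3 t h t0 h0 s1; rewrite mulr0n /=; lra.
Qed.

Lemma tail_le1 k t : 0 <= t -> s k t <= 1.
Proof.
move=> t0; elim: k => [|k]; first by rewrite (tail0 dyn).
by apply: le_trans; exact: (tail_noninc dyn).
Qed.

Lemma sum_indicator0 n (a : R) :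
  \sum_(k < n) (a *+ (k == 0%N :> nat)) = a *+ (0 < n)%N.
Proof.
case: n => [|n]; first by rewrite big_ord0.
by rewrite big_ord_recl /= big1 ?addr0.
Qed.

(** The sum to which [eventually_lt_of_dissipation] applies is that of the positive
parts of [s k - p k - eps]. The comparison tails [q] equal 1 at level 0 and are
strict supersolutions at level 1, where they lose [lam * eps]. *)
Lemma tail1_eventually_lt eps d : 0 < eps -> rho + eps < 1 -> 0 < d ->
  exists2 T, 0 <= T & forall t, T <= t -> s 1%N t - (rho + eps) < d.
Proof.
move=> e0 re1 d0.
have [L L0 hL] := tail_lipschitz dyn.
pose q k := p k + eps *+ (k != 0%N).
pose z k t := s k t - q k.
have qE : q 1%N = rho + eps by rewrite /q /= expr0 mulr1 mulr1n.
have qdrift k : lam * (q k - q k.+1) - mu * (q k.+1 - q k.+2) =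
    - (lams + lam * eps) *+ (k == 0%N).
  transitivity ((lam * (p k - p k.+1) - mu * (p k.+1 - p k.+2)) -
     (lam * eps) *+ (k == 0%N)).
    by rewrite /q /=; case: (k) => [|j] /=; rewrite ?mulr0n ?mulr1n; ring.
  by rewrite tail_fixed_drift; case: (k) => [|j] /=; rewrite ?mulr0n ?mulr1n; ring.
suff [T T0 hT] : exists2 T, 0 <= T & forall t, T <= t -> z 1%N t < d.
  by exists T => // t /hT; rewrite /z qE.
have th0 : 0 < eps / (2 * L) by rewrite divr_gt0// mulr_gt0.
apply: (@eventually_lt_of_dissipation R mu z L (eps / (2 * L))) => //.
- move=> n; pose eta := (1 - rho - eps) / 2.
  have eta0 : 0 < eta by rewrite divr_gt0//; lra.
  have [C1 C10 h1] := shared_ge; have [C2 C20 h2] := shared_sum n.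
  have [C3 C30 h3] := shared_le n eta0.
  exists (C2 + n%:R * C1 + n%:R * C3), (Num.min (lam + mu)^-1 (eta / L)).
  have lam_mu_ge0 : 0 < lam + mu by rewrite addr_gt0.
  split; first by rewrite lt_min invr_gt0 lam_mu_ge0 divr_gt0.
  move=> t h t0 h0; rewrite le_min => /andP[hlm hetaL].
  have hh : h * (lam + mu) <= 1 by rewrite -ler_pdivlMr// mul1r.
  have Lh : L * h <= eta by rewrite mulrC -ler_pdivlMr.
  have sq0 : 0 <= h ^+ 2 by rewrite sqr_ge0.
  have z0 : z 0%N t <= 0.
    by rewrite /z /q (tail0 dyn t0) /= mulr0n; lra.
  have zstep k : z k.+1 (t + h) = z k.+1 t +
     h * (lam * (z k t - z k.+1 t) - mu * (z k.+1 t - z k.+2 t))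
     + D k t h - h * (lams + lam * eps) *+ (k == 0%N).
    have := qdrift k; rewrite -mulrnAr mulNrn /z /D => E.
    have -> : (lams + lam * eps) *+ (k == 0%N) =
      - (lam * (q k - q k.+1) - mu * (q k.+1 - q k.+2)) by rewrite E opprK.
    ring.
  have le0 : 0 <= lam * eps by rewrite mulr_ge0// ltW.
  have hle0 : 0 <= h * (lam * eps) by rewrite mulr_ge0// ltW.
  (* If [z 1] is positive during the whole step, its positive part registers the
     missing share of level 1, which pays for the other levels. Otherwise
     level 1 is away from 1 and takes the whole shared stream. *)
  have [big|small] := leP (L * h) (z 1%N t).
    apply: (@excess_step R lam mu h _ z
      (fun k => D k t h + C1 * h ^+ 2 - h * lams *+ (k == 0%N))) => //; try exact: ltW.
      move=> k kn.
      have [c1 c2] := @convex_step _ lam mu h (z k t) (z k.+1 t) (z k.+2 t)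
         (ltW lam0) (ltW mu0) (ltW h0) hh.
      have Dk := h1 k t h t0 (ltW h0).
      have cc : 0 <= C1 * h ^+ 2 by rewrite mulr_ge0.
      case: k kn c1 c2 Dk => [|k] kn c1 c2 Dk.
        rewrite pos_part_id; first by rewrite zstep eqxx !mulr1n; lra.
        have := hL 1%N t h t0 (ltW h0); rewrite ler_norml => /andP[+ _].
        by move: big; rewrite /z; lra.
      apply: pos_part_le; last by rewrite /= mulr0n; lra.
      by rewrite zstep /= !mulr0n; lra.
    rewrite sumrB big_split /= sum_indicator0 sumr_const card_ord.
    have := h2 t h t0 (ltW h0).
    have : 0 <= n%:R * C3 * h ^+ 2 by rewrite mulr_ge0// mulr_ge0.
    have : 0 <= C2 * h ^+ 2 by rewrite mulr_ge0.
    rewrite -[(C1 * _) *+ n]mulr_natl.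
    case: (n) => [|n'] /=; last by rewrite mulr1n; lra.
    by rewrite big_ord0 mulr0n; lra.
  have s1 : s 1%N t <= 1 - eta.
    by move: small; rewrite /z qE /eta; move: Lh; rewrite /eta; lra.
  apply: (@excess_step R lam mu h _ z (fun k => C3 * h ^+ 2)) => //; try exact: ltW.
    move=> k kn.
    have [c1 c2] := @convex_step _ lam mu h (z k t) (z k.+1 t) (z k.+2 t)
       (ltW lam0) (ltW mu0) (ltW h0) hh.
    have cc : 0 <= C3 * h ^+ 2 by rewrite mulr_ge0.
    apply: pos_part_le; last by lra.
    have := h3 k t h kn t0 (ltW h0); rewrite s1 orbT => /(_ isT).
    rewrite zstep; case: (k == 0%N); rewrite ?mulr0n ?mulr1n; lra.
  rewrite sumr_const card_ord -[(C3 * _) *+ n]mulr_natl.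
  have : 0 <= n%:R * C1 * h ^+ 2 by rewrite mulr_ge0// mulr_ge0.
  have : 0 <= C2 * h ^+ 2 by rewrite mulr_ge0.
  by lra.
- move=> t e t0 ee0.
  have [n0 hn0] := tail_cvg0 dyn t0 (divr_gt0 e0 (ltr0n R 2)).
  exists n0.+1 => -[//|n] r n0n tr rt; rewrite pos_part_eq0 ?(ltW ee0)//.
  have := hn0 n.+1 (ltnW n0n).
  have := hL n.+1 t (r - t) t0; rewrite subr_ge0 => /(_ tr).
  have -> : t + (r - t) = r by ring.
  rewrite ler_norml => /andP[_].
  have : L * (r - t) <= L * (eps / (2 * L)) by rewrite ler_wpM2l ?(ltW L0)//; lra.
  have -> : L * (eps / (2 * L)) = eps / 2 by field; rewrite gt_eqF.
  have := tail_fixed_ge0 n.+1.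
  by rewrite /z /q mulr1n; lra.
- move=> t t0; have [n0 hn0] := tail_cvg0 dyn t0 e0.
  exists n0%:R => n.
  apply: le_trans (excess_mono z t (leq_addl n0 n)) _.
  rewrite /excess big_split_ord /= [X in _ + X]big1 ?addr0; last first.
    move=> i _; rewrite pos_part_eq0// /z /q /= mulr1n.
    have := hn0 (n0 + i).+1 (leqW (leq_addr _ _)).
    by have := tail_fixed_ge0 (n0 + i).+1 => /=; lra.
  apply: (@le_trans _ _ (\sum_(i < n0) 1)); last by rewrite sumr_const card_ord.
  apply: ler_sum => i _; apply: pos_part_le => //.
  have := tail_le1 i.+1 t0; have := tail_fixed_ge0 i.+1.
  by rewrite /z /q mulr1n; lra.
- move=> t h t0 h0; have := hL 1%N t h t0 h0; rewrite /z.
  by have -> : s 1%N (t + h) - q 1%N - (s 1%N t - q 1%N) = s 1%N (t + h) - s 1%N t by ring.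
Qed.

(** Here shared customers at higher levels only help, and level 1 receives its full
share whenever [s 1] is below its limit. The sum is bounded by that of the [p k],
so no margin is needed. *)
Lemma tail1_eventually_gt d : 0 < d ->
  exists2 T, 0 <= T & forall t, T <= t -> rho - s 1%N t < d.
Proof.
move=> d0.
have [L L0 hL] := tail_lipschitz dyn.
pose z k t := p k - s k t.
suff [T T0 hT] : exists2 T, 0 <= T & forall t, T <= t -> z 1%N t < d.
  by exists T => // t /hT; rewrite /z /= expr0 mulr1.
have r1 := rho_lt1.
apply: (@eventually_lt_of_dissipation R mu z L 1) => //.
- move=> n; pose eta := (1 - rho) / 2.
  have eta0 : 0 < eta by rewrite divr_gt0//; lra.
  have [C1 C10 h1] := shared_ge.
  have [C3 C30 h3] := shared1_ge eta0.
  exists (n%:R * (C1 + C3)), (Num.min (lam + mu)^-1 (eta / L)).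
  have lam_mu_ge0 : 0 < lam + mu by rewrite addr_gt0.
  split; first by rewrite lt_min invr_gt0 lam_mu_ge0 divr_gt0.
  move=> t h t0 h0; rewrite le_min => /andP[hlm hetaL].
  have hh : h * (lam + mu) <= 1 by rewrite -ler_pdivlMr// mul1r.
  have Lh : L * h <= eta by rewrite mulrC -ler_pdivlMr.
  have sq0 : 0 <= h ^+ 2 by rewrite sqr_ge0.
  have z0 : z 0%N t <= 0 by rewrite /z (tail0 dyn t0) /=; lra.
  have zstep k : z k.+1 (t + h) = z k.+1 t +
     h * (lam * (z k t - z k.+1 t) - mu * (z k.+1 t - z k.+2 t))
     + h * lams *+ (k == 0%N) - D k t h.
    have := tail_fixed_drift k; rewrite -mulrnAr mulNrn /z /D => E.
    have -> : lams *+ (k == 0%N) =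
      - (lam * (p k - p k.+1) - mu * (p k.+1 - p k.+2)) by rewrite E opprK.
    ring.
  apply: (@excess_step R lam mu h _ z (fun k => (C1 + C3) * h ^+ 2)) => //; try exact: ltW.
    move=> k kn.
    have [c1 c2] := @convex_step _ lam mu h (z k t) (z k.+1 t) (z k.+2 t)
       (ltW lam0) (ltW mu0) (ltW h0) hh.
    have cc : 0 <= C3 * h ^+ 2 by rewrite mulr_ge0.
    have cc1 : 0 <= C1 * h ^+ 2 by rewrite mulr_ge0.
    apply: pos_part_le; last by lra.
    have Dk := h1 k t h t0 (ltW h0).
    case: k kn c1 c2 Dk => [|k] kn c1 c2 Dk; last by rewrite zstep /= mulr0n; lra.
    have [s1|s1] := leP (s 1%N t) (1 - eta).
      by have := h3 t h t0 (ltW h0) s1; rewrite zstep eqxx mulr1n; lra.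
    have := hL 1%N t h t0 (ltW h0); rewrite ler_norml => /andP[+ _].
    move=> low; have : z 1%N (t + h) <= 0.
      by move: s1 Lh low; rewrite /z /= expr0 mulr1 /eta; lra.
    by lra.
  by rewrite sumr_const card_ord -[(_ * _) *+ n]mulr_natl; lra.
- move=> t e t0 ee0; have [n0 hn0] := tail_fixed_cvg0 ee0.
  exists n0 => n r n0n tr rt; apply: le_trans (hn0 n n0n).
  apply: pos_part_le; last exact: tail_fixed_ge0.
  have := tail_ge0 dyn n (le_trans t0 tr).
  by rewrite /z; lra.
- move=> t t0; exists (rho / (1 - sigma)) => n.
  apply: le_trans (tail_fixed_sum n).
  apply: ler_sum => i _; apply: pos_part_le; last exact: tail_fixed_ge0.
  by have := tail_ge0 dyn i.+1 t0; rewrite /z; lra.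
- move=> t h t0 h0; apply: le_trans (hL 1%N t h t0 h0); rewrite distrC /z.
  by rewrite le_eqVlt; apply/orP; left; apply/eqP; congr (`|_|); ring.
Qed.

(** Once [s 1] stays away from 1 the shared stream is known up to O(h^2), and an Euler
step expresses [h * mu * s k.+2] by the increment of [s k.+1] and by lower tails.
For a small fixed [h], all these are eventually as close to their limits as
desired. *)
Lemma tail_cvg k (d : R) : 0 < d ->
  exists2 T, 0 <= T & forall t, T <= t -> `|s k t - p k| <= d.
Proof.
have r1 := rho_lt1.
have A1 (e : R) : 0 < e -> exists2 T, 0 <= T & forall t, T <= t -> `|s 1%N t - p 1%N| <= e.
  move=> e0; pose eps := Num.min (e / 2) ((1 - rho) / 2).
  have eps0 : 0 < eps by rewrite lt_min !divr_gt0//; lra.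
  have eps1 : eps <= e / 2 by rewrite ge_min lexx.
  have eps2 : eps <= (1 - rho) / 2 by rewrite ge_min lexx orbT.
  have re : rho + eps < 1 by lra.
  have e2 : 0 < e / 2 by rewrite divr_gt0.
  have [T1 T10 h1] := tail1_eventually_lt eps0 re e2.
  have [T2 T20 h2] := tail1_eventually_gt e0.
  exists (T1 + T2); first by rewrite addr_ge0.
  move=> t Tt; have := h1 t; have := h2 t.
  rewrite /= expr0 mulr1 ler_norml => /(_ _)/[dup] g1 _ /(_ _)/[dup] g2 _.
  have g1' := g1 ltac:(lra); have g2' := g2 ltac:(lra).
  by apply/andP; split; lra.
move=> d0.
pose A j := forall e : R, 0 < e -> exists2 T, 0 <= T &
  forall t, T <= t -> `|s j t - p j| <= e.
suff [Ak _] : A k /\ A k.+1 by exact: Ak.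
elim: k => [|k [IH0 IH1]]; split=> //.
  by move=> e e0; exists 0 => // t t0; rewrite (tail0 dyn t0) subrr normr0 ltW.
move=> e e0.
pose eta := (1 - rho) / 2.
have eta0 : 0 < eta by rewrite divr_gt0//; lra.
have [C1 C10 h1] := shared_ge.
have [C2 C20 h2] := shared_le k.+1 eta0.
have [C3 C30 h3] := shared1_ge eta0.
pose C := C1 + C2 + C3.
have C0 : 0 <= C by rewrite !addr_ge0.
have me0 : 0 < mu * e by rewrite mulr_gt0.
pose h := Num.min 1 (mu * e / (2 * (C + 1))).
have C10' : 0 < 2 * (C + 1) by rewrite mulr_gt0//; lra.
have h0 : 0 < h by rewrite lt_min ltr01 divr_gt0.
have h1' : h <= 1 by rewrite ge_min lexx.
have Ch : C * h <= mu * e / 2.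
  have : h * (2 * (C + 1)) <= mu * e by rewrite -ler_pdivlMr// ge_min lexx orbT.
  by lra.
have cst1 : 0 < 2 + 2 * lam + mu by move: lam0 mu0; lra.
have cst0 : 0 < 2 * (2 + 2 * lam + mu) by rewrite mulr_gt0.
pose d' := h * (mu * e) / (2 * (2 + 2 * lam + mu)).
have d'0 : 0 < d' by rewrite divr_gt0// mulr_gt0.
have d'E : (2 + 2 * lam + mu) * d' = h * (mu * e) / 2.
  by rewrite /d'; field; rewrite gt_eqF.
have [T0 T00 g0] := IH0 _ d'0.
have [T1 T10 g1] := IH1 _ d'0.
have [T2 T20 g2] := A1 _ eta0.
exists (T0 + T1 + T2); first by rewrite !addr_ge0.
move=> t Tt.
have t0 : 0 <= t by lra.
have s1 : s 1%N t <= 1 - eta.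
  have := g2 t ltac:(lra); rewrite /= expr0 mulr1 ler_norml => /andP[_].
  by rewrite /eta; lra.
have hlow : - (C * h ^+ 2) <= D k t h - h * lams *+ (k == 0%N).
  have x1 : 0 <= C1 * h ^+ 2 by rewrite mulr_ge0// sqr_ge0.
  have x2 : 0 <= C2 * h ^+ 2 by rewrite mulr_ge0// sqr_ge0.
  have x3 : 0 <= C3 * h ^+ 2 by rewrite mulr_ge0// sqr_ge0.
  case: (k) => [|k'].
    by have := h3 t h t0 (ltW h0) s1; rewrite eqxx mulr1n /C; lra.
  by have := h1 k'.+1 t h t0 (ltW h0); rewrite mulr0n /C; lra.
have hup : D k t h - h * lams *+ (k == 0%N) <= C * h ^+ 2.
  have x1 : 0 <= C1 * h ^+ 2 by rewrite mulr_ge0// sqr_ge0.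
  have x3 : 0 <= C3 * h ^+ 2 by rewrite mulr_ge0// sqr_ge0.
  have := h2 k t h (ltnSn k) t0 (ltW h0); rewrite s1 orbT => /(_ isT).
  by rewrite /C; lra.
have E : h * (mu * (s k.+2 t - p k.+2)) =
    - (D k t h - h * lams *+ (k == 0%N))
    + (s k.+1 (t + h) - p k.+1) - (s k.+1 t - p k.+1)
    - h * lam * (s k t - p k) + h * (lam + mu) * (s k.+1 t - p k.+1).
  have := tail_fixed_drift k; rewrite -mulrnAr mulNrn /D => F.
  have -> : lams *+ (k == 0%N) =
    - (lam * (p k - p k.+1) - mu * (p k.+1 - p k.+2)) by rewrite F opprK.
  ring.
have : `|h * (mu * (s k.+2 t - p k.+2))| <= h * (mu * e).
  have lh0 : 0 <= h * lam by rewrite mulr_ge0// ltW.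
  have lmh0 : 0 <= h * (lam + mu) by rewrite mulr_ge0 ?ltW// addr_gt0.
  have n1 : `|h * lam * (s k t - p k)| <= h * lam * d'.
    by rewrite normrM (ger0_norm lh0) ler_wpM2l// g0//; lra.
  have n2 : `|h * (lam + mu) * (s k.+1 t - p k.+1)| <= h * (lam + mu) * d'.
    by rewrite normrM (ger0_norm lmh0) ler_wpM2l// g1//; lra.
  have n3 : h * lam * d' + h * (lam + mu) * d' <= (2 * lam + mu) * d'.
    rewrite -mulrDl ler_wpM2r ?(ltW d'0)//.
    have -> : h * lam + h * (lam + mu) = h * (2 * lam + mu) by ring.
    by rewrite ler_piMl//; move: lam0 mu0; lra.
  have n4 : C * h ^+ 2 <= h * (mu * e) / 2.
    have := ler_wpM2l (ltW h0) Ch; lra.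
  have := g1 t ltac:(lra); have := g1 (t + h) ltac:(lra).
  move: hlow hup n1 n2; rewrite E !ler_norml.
  move=> b1 b2 /andP[b3 b4] /andP[b5 b6] /andP[b7 b8] /andP[b9 b10].
  by apply/andP; split; lra.
by rewrite normrM (gtr0_norm h0) ler_pM2l// normrM (gtr0_norm mu0) ler_pM2l.
Qed.

End TailDynamics.

(** * Paths of the finite system *)

(** A right neighbourhood of each good time is good, and a time is good if all earlier
times are; so the infimum of the bad times cannot exist. *)
Lemma real_induction (R : realType) (a : R) (Q : R -> Prop) :
  Q a ->
  (forall t, a <= t -> Q t -> \forall s \near t^'+, Q s) ->
  (forall t, a < t -> (forall s, a <= s -> s < t -> Q s) -> Q t) ->
  forall t, a <= t -> Q t.
Proof.
move=> Qa right left t at_; apply: contrapT => nQt.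
pose B := [set x | a <= x /\ ~ Q x].
have hB : has_inf B by split; [exists t | exists a => x []].
pose c := inf B.
have ac : a <= c by apply: lb_le_inf; [exists t | move=> x []].
have below s : a <= s -> s < c -> Q s.
  move=> as_ sc; apply: contrapT => nQs; move: sc; rewrite ltNge => /negP; apply.
  by apply: ge_inf; [case: hB|].
have Qc : Q c.
  by move: ac; rewrite le_eqVlt => /orP[/eqP <- //|ac]; apply: left.
have := right c ac Qc; rewrite near_withinE near_simpl => /nbhs_ballP[e /= e0 he].
have [x [ax nQx] xce] := inf_adherent e0 hB.
have cx : c <= x by apply: ge_inf; [case: hB|].
move: cx; rewrite le_eqVlt => /orP[/eqP cE|cx]; first by apply: nQx; rewrite -cE.
apply: nQx; apply: he => //=.
by rewrite /ball /= distrC ltr_norml; apply/andP; split; move: xce; rewrite -/c; lra.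
Qed.

Section Paths.
Context {R : realType} (N : nat) (A S : 'I_N -> R -> nat) (G : R -> nat)
  (X : R -> 'I_N -> nat).
Hypothesis cA : forall i, counting_path (A i).
Hypothesis cS : forall i, counting_path (S i).
Hypothesis cG : counting_path G.
Hypothesis cX : forall i, step_path (fun t => X t i).
Hypothesis jump : forall t : R, 0 < t -> \forall s \near t^'-,
    exists2 j : 'I_N, (forall i, (X s j <= X s i)%N) &
      forall i, X t i =
        ((X s i - (S i t - S i s)) + (A i t - A i s)
         + (i == j) * (G t - G s))%N.

Definition events (s t : R) : nat :=
  (\sum_(i < N) (A i t - A i s) + \sum_(i < N) (S i t - S i s) + (G t - G s))%N.

Definition changed (s t : R) : nat := (\sum_(i < N) (X t i != X s i))%N.

Let Amono i s t : 0 <= s -> s <= t -> (A i s <= A i t)%N.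
Proof. by case: (cA i) => _ _; apply. Qed.
Let Smono i s t : 0 <= s -> s <= t -> (S i s <= S i t)%N.
Proof. by case: (cS i) => _ _; apply. Qed.
Let Gmono s t : 0 <= s -> s <= t -> (G s <= G t)%N.
Proof. by case: cG => _ _; apply. Qed.

Lemma events_add s r t : 0 <= s -> s <= r -> r <= t ->
  events s t = (events s r + events r t)%N.
Proof.
move=> s0 sr rt; rewrite /events.
have r0 : 0 <= r by exact: le_trans sr.
have -> : (\sum_(i < N) (A i t - A i s) =
    \sum_(i < N) (A i r - A i s) + \sum_(i < N) (A i t - A i r))%N.
  rewrite -big_split; apply: eq_bigr => i _ /=.
  by have := Amono i s0 sr; have := Amono i r0 rt; lia.
have -> : (\sum_(i < N) (S i t - S i s) =
    \sum_(i < N) (S i r - S i s) + \sum_(i < N) (S i t - S i r))%N.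
  rewrite -big_split; apply: eq_bigr => i _ /=.
  by have := Smono i s0 sr; have := Smono i r0 rt; lia.
by have := Gmono s0 sr; have := Gmono r0 rt; lia.
Qed.

Lemma events_right t : 0 <= t ->
  \forall s \near t^'+, [/\ forall i, A i s = A i t, forall i, S i s = S i t,
    G s = G t & forall i, X s i = X t i].
Proof.
move=> t0.
have hA : \forall s \near t^'+, forall i, A i s = A i t.
  by apply: filter_forall => i; case: (cA i) => _ [+ _] _; apply.
have hS : \forall s \near t^'+, forall i, S i s = S i t.
  by apply: filter_forall => i; case: (cS i) => _ [+ _] _; apply.
have hG : \forall s \near t^'+, G s = G t by case: cG => _ [+ _] _; apply.
have hX : \forall s \near t^'+, forall i, X s i = X t i.
  by apply: filter_forall => i; case: (cX i) => + _; apply.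
by near=> s; split; near: s.
Unshelve. all: by end_near. Qed.

Lemma left_jump a t : 0 <= a -> a < t -> exists s, [/\ a <= s, s < t &
  exists2 j : 'I_N, (forall i, (X s j <= X s i)%N) &
      forall i, X t i =
        ((X s i - (S i t - S i s)) + (A i t - A i s)
         + (i == j) * (G t - G s))%N].
Proof.
move=> a0 at_; have t0 : 0 < t by exact: le_lt_trans at_.
near t^'- => s; exists s; split.
- by near: s; apply: nbhs_left_ge.
- by near: s; apply: nbhs_left_lt.
- by near: s; exact: jump.
Unshelve. all: by end_near. Qed.

(** Each tick moves at most one queue. Simultaneous ticks are allowed here; a shared
customer is charged to the shortest queue that the jump rule designates. *)
Lemma changed_le_events s t : 0 <= s -> s <= t -> (changed s t <= events s t)%N.
Proof.
move=> s0; apply: (real_induction (Q := fun t => (changed s t <= events s t)%N)).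
- by rewrite /changed big1// => i _; rewrite eqxx.
- move=> {}t st ht; have t0 : 0 <= t by exact: le_trans st.
  apply: filterS (events_right t0) => r [EA ES EG EX].
  rewrite /changed /events EG.
  under eq_bigr do rewrite EX.
  under [X in (_ <= X + _ + _)%N]eq_bigr do rewrite EA.
  by under [X in (_ <= _ + X + _)%N]eq_bigr do rewrite ES.
- move=> {}t st IH; have [r [sr rt [j _ hj]]] := left_jump s0 st.
  have r0 : 0 <= r by exact: le_trans sr.
  rewrite (events_add s0 sr (ltW rt)).
  apply: (@leq_trans (changed s r + changed r t)).
    rewrite /changed -big_split /=; apply: leq_sum => i _.
    by have [->|_] := eqVneq (X r i) (X s i); last by case: (X t i != X s i).
  apply: leq_add; first exact: IH.
  rewrite /changed /events -big_split /=.
  apply: (@leq_trans (\sum_(i < N) ((A i t - A i r) + (S i t - S i r))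
      + \sum_(i < N) (i == j) * (G t - G r))%N).
    rewrite -big_split /=; apply: leq_sum => i _.
    have := hj i; case: (i == j); rewrite ?mul1n ?mul0n; case: eqP => //=; lia.
  rewrite leq_add2l (bigD1 j)//= eqxx mul1n big1 ?addn0// => i /negbTE ->.
  by rewrite mul0n.
Qed.

(** The jump rule speaks of infinitesimal intervals. It extends to an interval with at
most one tick, because on one side of any intermediate time nothing happens. *)
Lemma single_event (N0 : (0 < N)%N) s t : 0 <= s -> s <= t ->
  (events s t <= 1)%N ->
  exists2 j : 'I_N, (forall i, (X s j <= X s i)%N) &
      forall i, X t i =
        ((X s i - (S i t - S i s)) + (A i t - A i s)
         + (i == j) * (G t - G s))%N.
Proof.
move=> s0; move: t.
apply: (real_induction (Q := fun t => (events s t <= 1)%N ->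
  exists2 j : 'I_N, (forall i, (X s j <= X s i)%N) &
      forall i, X t i =
        ((X s i - (S i t - S i s)) + (A i t - A i s)
         + (i == j) * (G t - G s))%N)).
- move=> _; case: (@arg_minnP _ (Ordinal N0) xpredT (X s) isT) => j _ hj.
  by exists j => [i|i]; [exact: hj|rewrite !subnn muln0 subn0 !addn0].
- move=> t st ht; have t0 : 0 <= t by exact: le_trans st.
  apply: filterS (events_right t0) => r [EA ES EG EX].
  rewrite /events EG.
  under eq_bigr do rewrite EA.
  under [X in (_ + X + _ <= _)%N]eq_bigr do rewrite ES.
  move=> /ht[j j1 j2]; exists j => // i; by rewrite EA ES EX.
- move=> t st IH; have [r [sr rt [j hj1 hj2]]] := left_jump s0 st.
  have r0 : 0 <= r by exact: le_trans sr.
  rewrite (events_add s0 sr (ltW rt)) => e1.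
  have [j' j1 j2] := IH r sr rt (leq_trans (leq_addr _ _) e1).
  have no_event u v (uv : events u v = 0%N) :
      [/\ forall i, (A i v - A i u = 0)%N, forall i, (S i v - S i u = 0)%N &
          (G v - G u = 0)%N].
    move: uv; rewrite /events => /eqP; rewrite !addn_eq0 !sum_nat_eq0.
    move=> /andP[/andP[/forallP a /forallP b] /eqP c].
    by split=> // i; apply/eqP; [have := a i | have := b i]; rewrite implyTb.
  have [sr0|rt0] : events s r = 0%N \/ events r t = 0%N by lia.
    have [a0 b0 c0] := no_event _ _ sr0.
    have Xr i : X r i = X s i by rewrite j2 a0 b0 c0 muln0 subn0 !addn0.
    exists j => [i|i]; first by rewrite -!Xr.
    rewrite hj2 Xr.
    have := a0 i; have := b0 i; have := c0.
    have := Amono i s0 sr; have := Smono i s0 sr; have := Gmono s0 sr.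
    by move=> h1 h2 h3 h4 h5 h6; congr (_ - _ + _ + _ * _)%N; lia.
  have [a0 b0 c0] := no_event _ _ rt0.
  exists j' => // i.
  rewrite hj2 a0 b0 c0 muln0 subn0 !addn0 j2.
  have := a0 i; have := b0 i; have := c0.
  have := Amono i r0 (ltW rt); have := Smono i r0 (ltW rt); have := Gmono r0 (ltW rt).
  by move=> h1 h2 h3 h4 h5 h6; congr (_ - _ + _ + _ * _)%N; lia.
Qed.

End Paths.

(** * Means of bounded functions on a probability space *)

Section Mean.
Context {R : realType} (d : measure_display) (T : measurableType d)
  (P : probability T R).
Implicit Types f g : T -> R.

Definition bounded_mfun f : Prop :=
  measurable_fun setT f /\ exists M, forall w, `|f w| <= M.

Definition mean f : R := \int[P]_w f w.

Lemma bounded_mfun_integrable f : bounded_mfun f -> P.-integrable setT (EFin \o f).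
Proof.
move=> [mf [M hM]]; apply: measurable_bounded_integrable => //.
  by rewrite [X in (X < _)%E]probability_setT ltry.
exists M; split; first exact: num_real.
by move=> x Mx w _ /=; apply: le_trans (hM w) (ltW Mx).
Qed.

Lemma bounded_mfun_cst (c : R) : bounded_mfun (fun=> c).
Proof. by split; [exact: measurable_cst | exists `|c|]. Qed.

Lemma bounded_mfun_indic (B : set T) : measurable B -> bounded_mfun (\1_B).
Proof.
move=> mB; split; first exact: measurable_indic.
by exists 1 => w; rewrite indicE; case: (w \in B); rewrite ?normr1 ?normr0.
Qed.

Lemma bounded_mfunD f g : bounded_mfun f -> bounded_mfun g ->
  bounded_mfun (fun w => f w + g w).
Proof.
move=> [mf [M hM]] [mg [M' hM']]; split; first exact: measurable_funD.
by exists (M + M') => w; apply: le_trans (ler_normD _ _) _; exact: lerD.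
Qed.

Lemma bounded_mfunM f g : bounded_mfun f -> bounded_mfun g ->
  bounded_mfun (fun w => f w * g w).
Proof.
move=> [mf [M hM]] [mg [M' hM']]; split; first exact: measurable_funM.
by exists (M * M') => w; rewrite normrM ler_pM.
Qed.

Lemma bounded_mfunZ c f : bounded_mfun f -> bounded_mfun (fun w => c * f w).
Proof. by apply: bounded_mfunM; exact: bounded_mfun_cst. Qed.

Lemma bounded_mfunB f g : bounded_mfun f -> bounded_mfun g ->
  bounded_mfun (fun w => f w - g w).
Proof.
move=> hf hg; have -> : (fun w => f w - g w) = (fun w => f w + (-1) * g w).
  by apply/funext => w; rewrite mulN1r.
by apply: bounded_mfunD => //; exact: bounded_mfunZ.
Qed.

Lemma bounded_mfun_norm f : bounded_mfun f -> bounded_mfun (fun w => `|f w|).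
Proof.
move=> [mf [M hM]]; split; first exact: measurableT_comp.
by exists M => w; rewrite normr_id.
Qed.

Lemma bounded_mfun_sum (I : Type) (r : seq I) (h : I -> T -> R) :
  (forall i, bounded_mfun (h i)) -> bounded_mfun (fun w => \sum_(i <- r) h i w).
Proof.
move=> hh; elim: r => [|i r IH].
  under eq_fun do rewrite big_nil; exact: bounded_mfun_cst.
by under eq_fun do rewrite big_cons; apply: bounded_mfunD.
Qed.

Lemma bounded_mfun_nat (h : T -> nat) (g : nat -> R) M :
  (forall n, measurable [set w | h w = n]) -> (forall n, `|g n| <= M) ->
  bounded_mfun (fun w => g (h w)).
Proof.
move=> mh gM; split; last by exists M.
have mh' : measurable_fun setT h.
  move=> _ Y _; rewrite setTI.
  have -> : h @^-1` Y = \bigcup_(n in Y) [set w | h w = n].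
    by apply/seteqP; split => [w Yw|w [n Yn hn]]; [exists (h w)|rewrite /preimage/= hn].
  by apply: bigcup_measurable => n _.
by apply: measurableT_comp mh'.
Qed.

Lemma mean_cst c : mean (fun=> c) = c.
Proof. by rewrite /mean Rintegral_cst// [X in fine X]probability_setT mulr1. Qed.

Lemma meanD f g : bounded_mfun f -> bounded_mfun g ->
  mean (fun w => f w + g w) = mean f + mean g.
Proof. by move=> hf hg; rewrite /mean RintegralD//; exact: bounded_mfun_integrable. Qed.

Lemma meanB f g : bounded_mfun f -> bounded_mfun g ->
  mean (fun w => f w - g w) = mean f - mean g.
Proof. by move=> hf hg; rewrite /mean RintegralB//; exact: bounded_mfun_integrable. Qed.

Lemma meanZ c f : bounded_mfun f -> mean (fun w => c * f w) = c * mean f.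
Proof. by move=> hf; rewrite /mean RintegralZl//; exact: bounded_mfun_integrable. Qed.

Lemma mean_le f g : bounded_mfun f -> bounded_mfun g -> (forall w, f w <= g w) ->
  mean f <= mean g.
Proof.
by move=> hf hg fg; apply: le_Rintegral => //; exact: bounded_mfun_integrable.
Qed.

Lemma mean_ge0 f : (forall w, 0 <= f w) -> 0 <= mean f.
Proof. by move=> f0; apply: Rintegral_ge0. Qed.

Lemma mean_norm f : bounded_mfun f -> `|mean f| <= mean (fun w => `|f w|).
Proof. by move=> hf; apply: le_normr_Rintegral => //; exact: bounded_mfun_integrable. Qed.

Lemma mean_sum (I : Type) (r : seq I) (h : I -> T -> R) :
  (forall i, bounded_mfun (h i)) ->
  mean (fun w => \sum_(i <- r) h i w) = \sum_(i <- r) mean (h i).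
Proof.
move=> hh; elim: r => [|i r IH].
  by under eq_fun do rewrite big_nil; rewrite mean_cst big_nil.
under eq_fun do rewrite big_cons; rewrite meanD ?IH ?big_cons//.
exact: bounded_mfun_sum.
Qed.

Lemma mean_indic (B : set T) : measurable B -> mean (\1_B) = fine (P B).
Proof. by move=> mB; rewrite /mean /Rintegral integral_indic// setIT. Qed.

(** Simple functions with level sets in [F]: enough to express the state of finitely
many truncated queues, and stable under the induction of
[adapted_simple_indep]. *)
Inductive adapted_simple (F : set (set T)) : (T -> R) -> Prop :=
| adapted_simple_indic B c : F B -> adapted_simple F (fun w => c * \1_B w)
| adapted_simple_add f g : adapted_simple F f -> adapted_simple F g ->
    adapted_simple F (fun w => f w + g w).

Lemma adapted_simple_bounded F f : F `<=` measurable -> adapted_simple F f -> bounded_mfun f.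
Proof.
move=> Fm; elim=> [B c FB|{}f g _ hf _ hg]; last exact: bounded_mfunD.
by apply: bounded_mfunZ; apply: bounded_mfun_indic; exact: Fm.
Qed.

Lemma adapted_simple_indep F f (E : set T) (q : R) : F `<=` measurable -> measurable E ->
  (forall B, F B -> P (B `&` E) = (P B * q%:E)%E) -> adapted_simple F f ->
  mean (fun w => f w * \1_E w) = q * mean f.
Proof.
move=> Fm mE indep; elim=> [B c FB|{}f g sf hf sg hg].
  have mB := Fm _ FB.
  have -> : (fun w => c * \1_B w * \1_E w) = (fun w => c * (\1_(B `&` E) w : R)).
    by apply/funext => w; rewrite -mulrA indicI.
  rewrite !meanZ ?mean_indic//; try exact: bounded_mfun_indic; last first.
  - by apply: bounded_mfun_indic; exact: measurableI.
  - exact: measurableI.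
  by rewrite indep// fineM ?fin_num_measure//=; ring.
have bE := bounded_mfun_indic mE.
have bf := adapted_simple_bounded Fm sf; have bg := adapted_simple_bounded Fm sg.
under eq_fun do rewrite mulrDl.
by rewrite !meanD ?hf ?hg ?mulrDr//; exact: bounded_mfunM.
Qed.

Lemma adapted_simple_sum F (I : Type) (r : seq I) (h : I -> T -> R) : F set0 ->
  (forall i, adapted_simple F (h i)) -> adapted_simple F (fun w => \sum_(i <- r) h i w).
Proof.
move=> F0 hh; elim: r => [|i r IH].
  have -> : (fun w => \sum_(i <- [::]) h i w) = (fun w => 0 * (\1_set0 w)).
    by apply/funext => w; rewrite big_nil mul0r.
  exact: adapted_simple_indic.
by under eq_fun do rewrite big_cons; exact: adapted_simple_add.
Qed.

(** A function that is constant from [n] on is determined by finitely many level sets. *)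
Lemma adapted_simple_nat F (h : T -> nat) (g : nat -> R) n : F set0 -> F setT ->
  (forall v, F [set w | h w = v]) -> (forall v, (n <= v)%N -> g v = g n) ->
  adapted_simple F (fun w => g (h w)).
Proof.
move=> F0 FT Fh gn.
have -> : (fun w => g (h w)) = (fun w => g n * \1_setT w +
    \sum_(v <- iota 0 n) (g v - g n) * \1_[set w | h w = v] w).
  apply/funext => w; rewrite indicT mulr1.
  have [hn|nh] := ltnP (h w) n.
    rewrite (bigD1_seq (h w)) ?mem_iota ?iota_uniq//= big1 ?addr0.
      by rewrite indicE mem_set//= mulr1; ring.
    by move=> v vh; rewrite indicE memNset ?mulr0//= => /esym/eqP; rewrite (negbTE vh).
  rewrite big1_seq ?addr0 ?gn// => v /=; rewrite mem_iota add0n => /andP[_ vn].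
  by rewrite indicE memNset ?mulr0//= => vE; move: nh; rewrite vE leqNgt vn.
apply: adapted_simple_add; first exact: adapted_simple_indic.
by apply: adapted_simple_sum => // v; apply: adapted_simple_indic.
Qed.

End Mean.

(** * One short time step of the finite system *)

Lemma measurable_nat2 d (T : measurableType d) (h1 h2 : T -> nat)
    (Q : nat -> nat -> Prop) :
  (forall n, measurable [set w | h1 w = n]) ->
  (forall n, measurable [set w | h2 w = n]) ->
  measurable [set w | Q (h1 w) (h2 w)].
Proof.
move=> m1 m2.
have -> : [set w | Q (h1 w) (h2 w)] = \bigcup_m \bigcup_(k in Q m)
    ([set w | h1 w = m] `&` [set w | h2 w = k]).
  apply/seteqP; split => [w Qw|w [m _ [k Qk [hm hk]]]].
    by exists (h1 w) => //; exists (h2 w).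
  by rewrite /= hm hk.
apply: bigcupT_measurable => m; apply: bigcup_measurable => k _.
exact: measurableI.
Qed.

(** One index type for the dedicated arrivals, the services and the shared stream, so
that the events of a single tick are treated uniformly. *)
Local Notation channel N := ('I_N + 'I_N + 'I_1)%type.

Section Queues.
Context {R : realType} (lam lams mu : R) (N : nat) (d : measure_display)
  (T : measurableType d) (P : probability T R) (F : R -> set (set T))
  (A S : 'I_N -> R -> T -> nat) (G : R -> T -> nat) (X : R -> T -> 'I_N -> nat).
Hypothesis lam0 : 0 < lam.
Hypothesis lams0 : 0 < lams.
Hypothesis mu0 : 0 < mu.
Hypothesis N0 : (0 < N)%N.
Hypothesis HQ : driven_queues lam lams mu P F A S G X.

Implicit Types (h q r s t M : R) (g : nat -> R).

Definition clock (c : channel N) (t : R) (w : T) : nat :=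
  match c with inl (inl i) => A i t w | inl (inr i) => S i t w | inr _ => G t w end.
Definition clock_rate (c : channel N) : R :=
  match c with inl (inl i) => lam | inl (inr i) => mu | inr _ => N%:R * lams end.
Definition ticks (s t : R) (w : T) (c : channel N) : nat := (clock c t w - clock c s w)%N.
Definition single_tick (s t : R) (c : channel N) : set T :=
  [set w | forall c', ticks s t w c' = (c' == c)].
Definition no_tick (s t : R) : set T := [set w | forall c', ticks s t w c' = 0%N].
Definition total_rate : R := N%:R * (lam + mu + lams).
Definition tick_count (s t : R) (w : T) : nat :=
  events (fun i r => A i r w) (fun i r => S i r w) (fun r => G r w) s t.

Lemma sum_channel (V : nmodType) (f : channel N -> V) : \sum_c f c =
  \sum_(i < N) f (inl (inl i)) + \sum_(i < N) f (inl (inr i)) + f (inr ord0).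
Proof. by rewrite !big_sumType /= big_ord1. Qed.

Lemma prod_channel (f : channel N -> R) : \prod_c f c =
  (\prod_(i < N) f (inl (inl i))) * (\prod_(i < N) f (inl (inr i))) * f (inr ord0).
Proof. by rewrite !big_sumType /= big_ord1. Qed.

Lemma total_rateE : \sum_c clock_rate c = total_rate.
Proof.
rewrite sum_channel /= !sumr_const card_ord -(mulr_natl lam) -(mulr_natl mu) /total_rate.
by rewrite !mulrDr.
Qed.

Lemma clock_rate_gt0 c : 0 < clock_rate c.
Proof. by case: c => [[i|i]|i] //=; rewrite mulr_gt0// ltr0n. Qed.

Lemma total_rate_gt0 : 0 < total_rate.
Proof. by rewrite mulr_gt0 ?ltr0n// !addr_gt0. Qed.

Lemma tick_count_sum s t w : tick_count s t w = (\sum_c ticks s t w c)%N.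
Proof. by rewrite !big_sumType /= big_ord1. Qed.

Lemma F_measurable t : 0 <= t -> F t `<=` measurable.
Proof. by move=> t0; case: (filtration_sigma_algebra HQ t0). Qed.

Lemma clock_measurable c t n : 0 <= t -> measurable [set w | clock c t w = n].
Proof.
move=> t0; apply: (F_measurable t0).
have [hA [hS hG]] := streams_adapted HQ t0 n.
by case: c => [[i|i]|i]; [exact: hA|exact: hS|exact: hG].
Qed.

Lemma ticks_measurable (a : channel N -> nat) s t : 0 <= s -> s <= t ->
  measurable [set w | forall c, ticks s t w c = a c].
Proof.
move=> s0 st; have t0 : 0 <= t by exact: le_trans st.
have -> : [set w | forall c, ticks s t w c = a c] =
    \bigcap_(c in [set: channel N]) [set w | ticks s t w c = a c].
  by apply/seteqP; split => [w h c _|w h c]; exact: h.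
apply: fin_bigcap_measurable; first exact: finite_finset.
move=> c _.
apply: (@measurable_nat2 _ _ (clock c t) (clock c s) (fun m n => (m - n)%N = a c)).
  by move=> n; exact: clock_measurable.
by move=> n; exact: clock_measurable.
Qed.

Lemma ticks_poisson s t B (a : channel N -> nat) : 0 <= s -> s < t -> F s B ->
  P (B `&` [set w | forall c, ticks s t w c = a c]) =
  (P B * (\prod_c poisson_pmf (clock_rate c * (t - s)) (a c))%:E)%E.
Proof.
move=> s0 st FB.
rewrite prod_channel /=.
rewrite -(streams_poisson HQ s0 st (fun i => a (inl (inl i))) (fun i => a (inl (inr i)))
  (a (inr ord0)) FB).
congr (P (_ `&` _)); apply/seteqP; split => [w h|w [h1 h2 h3] c] /=.
  split=> [i|i|]; [exact: (h (inl (inl i)))|exact: (h (inl (inr i)))|].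
  exact: (h (inr ord0)).
by case: c => [[i|i]|i]; [exact: h1|exact: h2|rewrite (ord1 i); exact: h3].
Qed.

Lemma prod_expR (I : Type) (r : seq I) (p : pred I) (f : I -> R) :
  \prod_(i <- r | p i) expR (f i) = expR (\sum_(i <- r | p i) f i).
Proof. by rewrite (big_morph expR (@expRD R) (@expR0 R)). Qed.

Lemma no_tick_prob s t B : 0 <= s -> s < t -> F s B ->
  P (B `&` no_tick s t) = (P B * (expR (- (total_rate * (t - s))))%:E)%E.
Proof.
move=> s0 st FB; rewrite (ticks_poisson (fun=> 0%N) s0 st FB).
congr (_ * _%:E)%E.
transitivity (\prod_c expR (- (clock_rate c * (t - s)))).
  apply: eq_bigr => c _; rewrite /poisson_pmf mulr_gt0 ?clock_rate_gt0 ?subr_gt0//.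
  by rewrite expr0 fact0 invr1 !mul1r.
by rewrite prod_expR sumrN -mulr_suml total_rateE.
Qed.

Lemma single_tick_prob s t c B : 0 <= s -> s < t -> F s B ->
  P (B `&` single_tick s t c) =
  (P B * (clock_rate c * (t - s) * expR (- (total_rate * (t - s))))%:E)%E.
Proof.
move=> s0 st FB; rewrite (ticks_poisson (fun c' => c' == c : nat) s0 st FB).
congr (_ * _%:E)%E.
have rp c' : 0 < clock_rate c' * (t - s) by rewrite mulr_gt0 ?clock_rate_gt0 ?subr_gt0.
rewrite (bigD1 c)//= eqxx {1}/poisson_pmf rp expr1 (_ : 1`! = 1%N)//.
rewrite invr1 mulr1 -(mulrA (clock_rate c * (t - s))).
congr (_ * _); rewrite -total_rateE mulr_suml -sumrN.
rewrite -(prod_expR _ xpredT) [RHS](bigD1 c)//=.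
congr (_ * _); apply: eq_bigr => c' /negbTE -> /=.
by rewrite /poisson_pmf rp expr0 fact0 invr1 !mul1r.
Qed.

(** The indicator of at least two ticks, in a form whose expectation is computed from
the probabilities of no tick and of one given tick. *)
Definition multiple_ticks (s t : R) (w : T) : R :=
  1 - \1_(no_tick s t) w - \sum_c \1_(single_tick s t c) w.

Lemma sum_nat_le1 (I : finType) (f : I -> nat) : (\sum_i f i <= 1)%N ->
  (forall i, f i = 0%N) \/ exists i0, forall i, f i = (i == i0).
Proof.
move=> h; have [f0|/forallPn/=[i0 hi0]] := boolP [forall i, f i == 0%N].
  by left=> i; apply/eqP; move/forallP: f0.
right; exists i0 => i; move: h; rewrite (bigD1 i0)//=.
case: eqVneq => [->|ii0]; first by move: hi0; lia.
by rewrite (bigD1 i)//=; move: hi0; lia.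
Qed.

Lemma event_cases s t w :
  [\/ [/\ forall c, ticks s t w c = 0%N, \1_(no_tick s t) w = 1 :> R &
          forall c, \1_(single_tick s t c) w = 0 :> R],
      (exists c, [/\ forall c', ticks s t w c' = (c' == c), \1_(no_tick s t) w = 0 :> R &
          forall c', \1_(single_tick s t c') w = (c' == c)%:R :> R]) |
      [/\ (1 < tick_count s t w)%N, \1_(no_tick s t) w = 0 :> R &
          forall c, \1_(single_tick s t c) w = 0 :> R]].
Proof.
have [h|h] := leqP (tick_count s t w) 1; last first.
  apply: Or33; split=> // [|c]; rewrite indicE memNset// => q; move: h.
    by rewrite tick_count_sum big1.
  rewrite tick_count_sum (bigD1 c)//= q eqxx big1// => c' /negbTE cc.
  by rewrite q cc.
have := h; rewrite tick_count_sum => /sum_nat_le1[h0|[c hc]].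
  apply: Or31; split=> // [|c]; rewrite indicE.
    by rewrite mem_set.
  by rewrite memNset// => /(_ c); rewrite h0 eqxx.
apply: Or32; exists c; split=> // [|c']; rewrite indicE.
  by rewrite memNset// => /(_ c); rewrite hc eqxx.
case: eqVneq => [->|cc]; first by rewrite mem_set.
by rewrite memNset// => /(_ c'); rewrite hc eqxx (negbTE cc).
Qed.

Lemma bounded_single_tick s t c : 0 <= s -> s <= t ->
  bounded_mfun (\1_(single_tick s t c) : T -> R).
Proof. by move=> s0 st; apply: bounded_mfun_indic; exact: ticks_measurable. Qed.

Lemma bounded_no_tick s t : 0 <= s -> s <= t -> bounded_mfun (\1_(no_tick s t) : T -> R).
Proof. by move=> s0 st; apply: bounded_mfun_indic; exact: ticks_measurable. Qed.

Lemma bounded_multiple_ticks s t : 0 <= s -> s <= t -> bounded_mfun (multiple_ticks s t).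
Proof.
move=> s0 st; apply: bounded_mfunB; last first.
  by apply: bounded_mfun_sum => c; exact: bounded_single_tick.
by apply: bounded_mfunB; [exact: bounded_mfun_cst|exact: bounded_no_tick].
Qed.

Lemma F_setT s : 0 <= s -> F s setT.
Proof.
move=> s0; case: (filtration_sigma_algebra HQ s0) => -[F0 FC _] _.
by rewrite -(setD0 setT); exact: FC.
Qed.

Lemma F_set0 s : 0 <= s -> F s set0.
Proof. by move=> s0; case: (filtration_sigma_algebra HQ s0) => -[]. Qed.

Lemma mean_single_tick s t c : 0 <= s -> s < t ->
  mean P (\1_(single_tick s t c)) = clock_rate c * (t - s) * expR (- (total_rate * (t - s))).
Proof.
move=> s0 st; rewrite mean_indic; last by apply: ticks_measurable => //; exact: ltW.
have := single_tick_prob c s0 st (F_setT s0); rewrite setTI => ->.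
by rewrite [X in (X * _)%E]probability_setT mul1e.
Qed.

(** With [x] the expected number of ticks, the probability of two or more is
1 - (1 + x) exp (- x) <= 1 - (1 + x) (1 - x). *)
Lemma mean_multiple_ticks s t : 0 <= s -> s < t ->
  mean P (multiple_ticks s t) <= (total_rate * (t - s)) ^+ 2.
Proof.
move=> s0 st; have st' := ltW st; rewrite /multiple_ticks meanB; last first.
- by apply: bounded_mfun_sum => c; exact: bounded_single_tick.
- by apply: bounded_mfunB; [exact: bounded_mfun_cst|exact: bounded_no_tick].
rewrite meanB ?mean_cst//; [|exact: bounded_mfun_cst|exact: bounded_no_tick].
rewrite mean_sum; last by move=> c; exact: bounded_single_tick.
under eq_bigr do rewrite mean_single_tick//.
rewrite -mulr_suml -mulr_suml total_rateE.
have -> : mean P (\1_(no_tick s t)) = expR (- (total_rate * (t - s))).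
  rewrite mean_indic; last exact: ticks_measurable.
  have := no_tick_prob s0 st (F_setT s0); rewrite setTI => ->.
  by rewrite [X in (X * _)%E]probability_setT mul1e.
set x := total_rate * (t - s).
have x0 : 0 <= x by rewrite mulr_ge0 ?(ltW total_rate_gt0)// subr_ge0.
have := expR_ge1Dx (- x) => e1.
have : (1 + x) * (1 - x) <= (1 + x) * expR (- x) by rewrite ler_wpM2l//; lra.
lra.
Qed.

Lemma counting w : [/\ forall i, counting_path (A i ^~ w),
  forall i, counting_path (S i ^~ w) & counting_path (G ^~ w)].
Proof. by have [a [b c]] := streams_counting HQ w. Qed.

(** A bound for the change of any proportion of queues between [s] and [t]; the
truncation at 1 keeps it integrable without moments of Poisson variables. *)
Definition activity (s t : R) (w : T) : R := Num.min 1 ((tick_count s t w)%:R / N%:R).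

Lemma tick_count_measurable s t n : 0 <= s -> s <= t ->
  measurable [set w | tick_count s t w = n].
Proof.
move=> s0 st; have t0 : 0 <= t by exact: le_trans st.
suff : forall (r : seq (channel N)) n, measurable [set w | (\sum_(c <- r) ticks s t w c)%N = n].
  by under eq_set do rewrite tick_count_sum; apply.
elim=> [|c r IH] m.
  have [->|m0] := eqVneq m 0%N.
    rewrite (_ : [set w | _] = setT); first exact: measurableT.
    by apply/seteqP; split => // w _ /=; rewrite big_nil.
  rewrite (_ : [set w | _] = set0); first exact: measurable0.
  by apply/seteqP; split => // w /=; rewrite big_nil => /esym/eqP; rewrite (negbTE m0).
under eq_set do rewrite big_cons.
apply: (@measurable_nat2 _ _ (fun w => ticks s t w c)
  (fun w => (\sum_(c <- r) ticks s t w c)%N) (fun a b => (a + b)%N = m)) => // n'.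
apply: (@measurable_nat2 _ _ (clock c t) (clock c s) (fun m n => (m - n)%N = n')).
  by move=> ?; exact: clock_measurable.
by move=> ?; exact: clock_measurable.
Qed.

Lemma bounded_activity s t : 0 <= s -> s <= t -> bounded_mfun (activity s t).
Proof.
move=> s0 st.
apply: (@bounded_mfun_nat _ _ _ (tick_count s t) (fun n => Num.min 1 (n%:R / N%:R)) 1).
  by move=> n; exact: tick_count_measurable.
by move=> n; rewrite ger0_norm ?ge_min ?lexx.
Qed.

Lemma activity_ge0 s t w : 0 <= activity s t w.
Proof. by rewrite le_min ler01 divr_ge0. Qed.

Lemma activity_step s t : 0 <= s -> s < t -> mean P (activity s t) <=
   (t - s) * (lam + mu + lams) + total_rate ^+ 2 * (t - s) ^+ 2.
Proof.
move=> s0 st; have st' := ltW st.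
have bs : bounded_mfun (fun w => \sum_c (\1_(single_tick s t c) w : R)).
  by apply: bounded_mfun_sum => c; exact: bounded_single_tick.
apply: (@le_trans _ _ (mean P (fun w => N%:R^-1 * (\sum_c \1_(single_tick s t c) w) + multiple_ticks s t w))).
  apply: mean_le; first exact: bounded_activity.
    by apply: bounded_mfunD; [exact: bounded_mfunZ|exact: bounded_multiple_ticks].
  move=> w; rewrite /multiple_ticks; case: (event_cases s t w) => [[h1 -> h]|[c [h1 -> h]]|[h1 -> h]].
  - rewrite big1 ?mulr0 ?subr0 ?subrr//.
    by rewrite addr0 /activity tick_count_sum big1 ?mul0r ?ge_min ?lexx ?orbT// => c _; exact: h1.
  - rewrite (bigD1 c)//= big1 ?addr0; last by move=> c' /negbTE cc; rewrite h cc.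
    rewrite h eqxx /activity tick_count_sum (bigD1 c)//= h1 eqxx.
    rewrite big1 ?addn0; last by move=> c' /negbTE cc; rewrite h1 cc.
    by rewrite mulr1 mul1r subr0 subrr addr0 ge_min lexx orbT.
  - rewrite big1 ?mulr0 ?subr0; last by move=> c _; exact: h.
    by rewrite add0r /activity ge_min lexx.
rewrite meanD; [|exact: bounded_mfunZ|exact: bounded_multiple_ticks].
rewrite -exprMn; apply: lerD; last exact: mean_multiple_ticks.
rewrite meanZ// mean_sum; last by move=> c; exact: bounded_single_tick.
under eq_bigr do rewrite mean_single_tick//.
rewrite -mulr_suml -mulr_suml total_rateE.
have e1 : expR (- (total_rate * (t - s))) <= 1.
  apply: (@le_trans _ _ (expR 0)); last by rewrite expR0.
  by rewrite ler_expR oppr_le0 mulr_ge0 ?subr_ge0// ltW// total_rate_gt0.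
have NN : N%:R != 0 :> R by rewrite pnatr_eq0 -lt0n.
apply: (@le_trans _ _ (N%:R^-1 * (total_rate * (t - s)))).
  by rewrite ler_wpM2l ?invr_ge0// ler_piMr// mulr_ge0 ?subr_ge0// ltW// total_rate_gt0.
by rewrite /total_rate !mulrA mulVf// mul1r mulrC.
Qed.

(** The activity is subadditive over adjacent intervals, so the bound for short
intervals extends to all. *)
Lemma activity_mean s t : 0 <= s -> s <= t ->
  mean P (activity s t) <= (t - s) * (lam + mu + lams).
Proof.
move=> s0 st.
have act0 r : mean P (activity r r) = 0.
  rewrite (_ : activity r r = fun=> 0) ?mean_cst//.
  apply/funext => w; rewrite /activity tick_count_sum big1 ?mul0r ?(min_idPr _)//.
  by move=> c _; rewrite /ticks subnn.
have := @euler_le R (fun r => mean P (activity s r)) s (t - s) (lam + mu + lams)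
  (total_rate ^+ 2) 1; rewrite act0 add0r [s + _]addrC subrK; apply; rewrite ?subr_ge0//.
move=> r q sr _ q0 _; have r0 : 0 <= r by exact: le_trans sr.
have rq : r < r + q by rewrite ltrDl.
have := activity_step r0 rq; rewrite addrAC subrr add0r => st1.
rewrite -addrA; apply: le_trans (lerD (lexx _) st1).
have b1 := bounded_activity s0 sr; have b2 := bounded_activity r0 (ltW rq).
rewrite -meanD//; apply: mean_le.
- by apply: bounded_activity => //; apply: le_trans (ltW rq).
- exact: bounded_mfunD.
move=> w; have [cA cS cG] := counting w.
rewrite /activity {1}/tick_count (events_add cA cS cG s0 sr (ltW rq)) natrD mulrDl.
rewrite -/(tick_count s r w) -/(tick_count r (r + q) w).
have e1 : 0 <= (tick_count s r w)%:R / N%:R :> R by rewrite divr_ge0.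
have e2 : 0 <= (tick_count r (r + q) w)%:R / N%:R :> R by rewrite divr_ge0.
move: e1 e2; set x := _ / _; set y := _ / _ => x0 y0.
rewrite ge_min; apply/orP; case: (leP 1 x) => hx; case: (leP 1 y) => hy;
  by [left; lra | right; lra].
Qed.

Lemma activity_mono s' s t t' w : 0 <= s' -> s' <= s -> s <= t -> t <= t' ->
  activity s t w <= activity s' t' w.
Proof.
move=> s0 ss st tt; have [cA cS cG] := counting w.
rewrite /activity le_min ge_min lexx /= ge_min; apply/orP; right.
rewrite ler_wpM2r// ler_nat /tick_count.
rewrite (events_add cA cS cG s0 ss (le_trans st tt)).
rewrite (events_add cA cS cG (le_trans s0 ss) st tt).
by apply: leq_trans (leq_addl _ _); exact: leq_addr.
Qed.

Definition queue_avg (g : nat -> R) (t : R) (w : T) : R := (\sum_(i < N) g (X t w i)) / N%:R.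

Let NR0 : 0 < N%:R :> R. Proof. by rewrite ltr0n. Qed.
Let NV0 : 0 < N%:R^-1 :> R. Proof. by rewrite invr_gt0. Qed.

Lemma bounded_queue (g : nat -> R) M t i : 0 <= t -> (forall n, `|g n| <= M) ->
  bounded_mfun (fun w => g (X t w i)).
Proof.
move=> t0 gM; apply: (bounded_mfun_nat (M := M)) => // n.
by apply: (F_measurable t0); exact: (queues_adapted HQ).
Qed.

Lemma bounded_queue_avg g M t : 0 <= t -> (forall n, `|g n| <= M) ->
  bounded_mfun (queue_avg g t).
Proof.
move=> t0 gM; rewrite /queue_avg.
have -> : (fun w => (\sum_(i < N) g (X t w i)) / N%:R) =
  (fun w => N%:R^-1 * (\sum_(i < N) g (X t w i))) by apply/funext => w; rewrite mulrC.
by apply: bounded_mfunZ; apply: bounded_mfun_sum => i; exact: (bounded_queue (M := M)).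
Qed.

Lemma queue_avg_change (g : nat -> R) (kap s t : R) w : 0 <= kap ->
  (forall x y, `|g x - g y| <= kap) ->
  0 <= s -> s <= t -> `|queue_avg g t w - queue_avg g s w| <= kap * activity s t w.
Proof.
move=> kap0 hg s0 st.
rewrite /queue_avg -mulrBl -sumrB normrM (gtr0_norm NV0).
have le1 (V : R) : V <= (changed (fun r => X r w) s t)%:R * kap ->
    V <= N%:R * kap -> V / N%:R <= kap * activity s t w.
  move=> V1 V2; rewrite ler_pdivrMr// -mulrA.
  have V3 : V <= (tick_count s t w)%:R * kap.
    apply: le_trans V1 _; rewrite ler_wpM2r// ler_nat.
    have [cA cS cG] := counting w.
    by apply: changed_le_events => //; [exact: (queues_step HQ)|exact: (queues_jump HQ)].
  rewrite /activity; case: (leP 1 (_ / _)) => _; first by rewrite mul1r mulrC.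
  by rewrite divfK ?gt_eqF// mulrC.
apply: le1.
- apply: le_trans (ler_norm_sum _ _ _) _.
  rewrite /changed natr_sum mulr_suml; apply: ler_sum => i _.
  by have [->|] := eqVneq (X t w i) (X s w i); rewrite /= ?subrr ?normr0 ?mul0r ?mul1r.
- apply: le_trans (ler_norm_sum _ _ _) _.
  apply: (@le_trans _ _ (\sum_(i < N) kap)); first by apply: ler_sum => i _.
  by rewrite sumr_const card_ord mulr_natl.
Qed.

(** The generator of the dedicated arrivals and services of one queue; the truncated
predecessor makes services at an empty queue void. *)
Definition generator (g : nat -> R) (x : nat) : R :=
  lam * (g x.+1 - g x) + mu * (g x.-1 - g x).

Definition jump_effect (g : nat -> R) (gam : T -> R) s (c : channel N) (w : T) : R :=
  match c with
  | inl (inl i) => g (X s w i).+1 - g (X s w i)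
  | inl (inr i) => g (X s w i).-1 - g (X s w i)
  | inr _ => gam w end.

(** The only unknown is the queue that receives a shared customer; [gam] is a lower
bound for the effect over all shortest queues. *)
Lemma one_step_path (g : nat -> R) (M : R) gam (s t : R) w : 0 <= s -> s <= t -> 0 <= M ->
  (forall n, `|g n| <= M) ->
  (forall j, (forall i, (X s w j <= X s w i)%N) ->
     gam w <= g (X s w j).+1 - g (X s w j)) ->
  N%:R^-1 * (\sum_c jump_effect g gam s c w * \1_(single_tick s t c) w)
    - 2 * M * multiple_ticks s t w <= queue_avg g t w - queue_avg g s w.
Proof.
move=> s0 st M0 gM hgam.
rewrite /queue_avg -mulrBl -sumrB [_ / N%:R]mulrC.
have [cA cS cG] := counting w.
have single := single_event cA cS cG (queues_step HQ w) (queues_jump HQ w) N0 s0 st.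
rewrite /multiple_ticks; case: (event_cases s t w) => [[h1 -> h]|[c [h1 -> h]]|[h1 -> h]].
- rewrite big1; last by move=> c _; rewrite h mulr0.
  have [|j _ hX] := single; first by rewrite -/(tick_count s t w) tick_count_sum big1.
  rewrite !big1 ?mulr0 ?subr0 ?subrr ?mulr0//.
  move=> i _; rewrite hX.
  have := h1 (inl (inl i)); have := h1 (inl (inr i)); have := h1 (inr ord0).
  by rewrite /ticks /= => -> -> ->; rewrite muln0 subn0 !addn0 subrr.
- rewrite (bigD1 c)//= big1; last first.
    by move=> c' /negbTE cc; rewrite h cc mulr0.
  rewrite h eqxx mulr1 addr0 (bigD1 c)//= h eqxx big1; last first.
    by move=> c' /negbTE cc; rewrite h cc.
  rewrite addr0 subr0 subrr mulr0 subr0 ler_wpM2l ?invr_ge0 ?(ltW NR0)//.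
  have [|j hj hX] := single.
    rewrite -/(tick_count s t w) tick_count_sum (bigD1 c)//= h1 eqxx big1// => c' /negbTE cc.
    by rewrite h1 cc.
  have hX' i : X t w i = (X s w i - (inl (inr i) == c) + (inl (inl i) == c)
      + (i == j) * ((inr ord0 : channel N) == c))%N.
    rewrite hX; have := h1 (inl (inl i)); have := h1 (inl (inr i)).
    by have := h1 (inr ord0); rewrite /ticks /= => -> -> ->.
  case: c {h h1} hX' => [[i0|i0]|i0] hX' /=.
  + rewrite (bigD1 i0)//= big1 ?addr0.
      by rewrite hX' eqxx /= muln0 subn0 addn0 addn1.
    move=> i /negbTE ii; rewrite hX' [_ == inl (inl i0)]/= muln0 subn0 addn0.
    by rewrite (_ : (inl (inl i) == _) = (i == i0))// ii addn0 subrr.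
  + rewrite (bigD1 i0)//= big1 ?addr0.
      by rewrite hX' eqxx /= muln0 !addn0 subn1.
    move=> i /negbTE ii; rewrite hX' [inl (inl i) == _]/= muln0 !addn0.
    by rewrite (_ : (inl (inr i) == _) = (i == i0))// ii subn0 subrr.
  + rewrite (bigD1 j)//= big1 ?addr0.
      rewrite hX' eqxx mul1n (_ : (inr ord0 == _) = true) ?(ord1 i0)//=.
      by rewrite subn0 addn0 addn1; exact: hgam.
    move=> i /negbTE ii; rewrite hX' ii mul0n /= subn0 !addn0 subrr//.
- have -> : \sum_c jump_effect g gam s c w * \1_(single_tick s t c) w = 0.
    by apply: big1 => c _; rewrite h mulr0.
  have -> : \sum_c \1_(single_tick s t c) w = 0 :> R by apply: big1 => c _; exact: h.
  rewrite mulr0 !subr0 mulr1 sub0r lerNl -mulrN ler_pdivrMl//.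
  rewrite -sumrN.
  apply: (@le_trans _ _ (\sum_(i < N) 2 * M)); last first.
    by rewrite sumr_const card_ord -[X in X <= _]mulr_natl.
  apply: ler_sum => i _; have := gM (X t w i); have := gM (X s w i).
  by rewrite !ler_norml => /andP[a b] /andP[a' b']; lra.
Qed.

Lemma adapted_simple_jump_effect g n gam s c : 0 <= s ->
  (forall v, (n <= v)%N -> g v = g n) -> adapted_simple (F s) gam ->
  adapted_simple (F s) (jump_effect g gam s c).
Proof.
move=> s0 gn sg; have F0 := F_set0 s0; have FT := F_setT s0.
case: c => [[i|i]|i] //=.
- apply: (@adapted_simple_nat _ _ _ (F s) (fun w => X s w i) (fun x => g x.+1 - g x) n F0 FT).
    by move=> v; exact: (queues_adapted HQ).
  by move=> v nv; rewrite (gn v)// gn ?(gn n.+1)//; lia.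
- apply: (@adapted_simple_nat _ _ _ (F s) (fun w => X s w i) (fun x => g x.-1 - g x) n.+1 F0 FT).
    by move=> v; exact: (queues_adapted HQ).
  by move=> v nv; rewrite (gn v) ?gn//=; lia.
Qed.

(** The state at time [s] is independent of which clock ticks next, so [one_step_path]
turns into a drift computed at time [s]. *)
Lemma one_step_mean (g : nat -> R) n (M Gam : R) : 0 <= M -> 0 <= Gam -> (forall v, `|g v| <= M) ->
  (forall v, (n <= v)%N -> g v = g n) ->
  exists2 K, 0 <= K & forall (s h : R) gam, 0 <= s -> 0 < h ->
  adapted_simple (F s) gam -> (forall w, `|gam w| <= Gam) ->
  (forall w j, (forall i, (X s w j <= X s w i)%N) ->
     gam w <= g (X s w j).+1 - g (X s w j)) ->
  mean P (queue_avg g s) + h * (mean P (queue_avg (generator g) s) + lams * mean P gam)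
    - K * h ^+ 2 <= mean P (queue_avg g (s + h)).
Proof.
move=> M0 Gam0 gM gn.
pose Q := (lam + mu) * (2 * M) + lams * Gam.
have Q0 : 0 <= Q by rewrite addr_ge0 ?mulr_ge0 ?addr_ge0// ltW.
exists (total_rate * Q + 2 * M * total_rate ^+ 2).
  have tt := ltW total_rate_gt0.
  apply: addr_ge0; first exact: mulr_ge0.
  by apply: mulr_ge0; [exact: mulr_ge0|exact: sqr_ge0].
move=> s h gam s0 h0 sgam gamb hgam.
have sh : s < s + h by rewrite ltrDl.
have sh' := ltW sh; have sh0 : 0 <= s + h by exact: le_trans sh'.
have sj c := adapted_simple_jump_effect c s0 gn sgam.
have bj c := adapted_simple_bounded (F_measurable s0) (sj c).
have bjo c : bounded_mfun (fun w => jump_effect g gam s c w * \1_(single_tick s (s + h) c) w).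
  by apply: bounded_mfunM => //; exact: bounded_single_tick.
have bg r (r0 : 0 <= r) := bounded_queue_avg r0 gM.
have bb := bounded_multiple_ticks s0 sh'.
have bsum : bounded_mfun (fun w =>
    \sum_c jump_effect g gam s c w * \1_(single_tick s (s + h) c) w).
  exact: bounded_mfun_sum.
have : mean P (fun w => N%:R^-1 *
    (\sum_c jump_effect g gam s c w * \1_(single_tick s (s + h) c) w)
    - 2 * M * multiple_ticks s (s + h) w) <= mean P (fun w => queue_avg g (s + h) w - queue_avg g s w).
  apply: mean_le.
  - by apply: bounded_mfunB; exact: bounded_mfunZ.
  - by apply: bounded_mfunB; exact: bg.
  - by move=> w; apply: one_step_path => // j; exact: hgam.
rewrite (meanB P (bounded_mfunZ _ bsum) (bounded_mfunZ _ bb)).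
rewrite (meanZ P _ bsum) (meanZ P _ bb) (meanB P (bg _ sh0) (bg _ s0)) (mean_sum P _ bjo).
have mj c : mean P (fun w => jump_effect g gam s c w * \1_(single_tick s (s + h) c) w) =
    clock_rate c * h * expR (- (total_rate * h)) * mean P (jump_effect g gam s c).
  apply: (adapted_simple_indep (F_measurable s0)) => //; first exact: ticks_measurable.
  by move=> B FB; rewrite single_tick_prob// addrAC subrr add0r.
under eq_bigr do rewrite mj.
have gen2M v : `|generator g v| <= (lam + mu) * (2 * M).
  apply: le_trans (ler_normD _ _) _; rewrite mulrDl.
  have nb a b : `|g a - g b| <= 2 * M.
    by apply: le_trans (ler_normB _ _) _; have := gM a; have := gM b; lra.
  by rewrite !normrM (gtr0_norm lam0) (gtr0_norm mu0) lerD// ler_wpM2l ?(ltW lam0) ?(ltW mu0).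
have bgen := bounded_queue_avg s0 gen2M.
have bgam := adapted_simple_bounded (F_measurable s0) sgam.
set Dr := mean P (queue_avg (generator g) s) + lams * mean P gam.
have sumE : \sum_c clock_rate c * mean P (jump_effect g gam s c) = N%:R * Dr.
  transitivity (mean P (fun w => \sum_c clock_rate c * jump_effect g gam s c w)).
    rewrite mean_sum; last by move=> c; exact: bounded_mfunZ.
    by apply: eq_bigr => c _; rewrite meanZ.
  rewrite /Dr -meanZ// -meanD//; last exact: bounded_mfunZ.
  rewrite -meanZ; last by apply: bounded_mfunD => //; exact: bounded_mfunZ.
  congr mean; apply/funext => w.
  rewrite sum_channel /= -big_split /= /queue_avg /generator.
  by set Sg := \sum_(i < N) _; field; rewrite gt_eqF.
have DrQ : `|Dr| <= Q.
  apply: le_trans (ler_normD _ _) _; rewrite normrM (gtr0_norm lams0) lerD//.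
    apply: le_trans (mean_norm P bgen) _.
    rewrite -[leRHS](mean_cst P); apply: mean_le; [exact: bounded_mfun_norm|exact: bounded_mfun_cst|].
    move=> w; rewrite /queue_avg normrM (gtr0_norm NV0) ler_pdivrMr//.
    apply: le_trans (ler_norm_sum _ _ _) _.
    apply: (@le_trans _ _ (\sum_(i < N) (lam + mu) * (2 * M))); first exact: ler_sum.
    by rewrite sumr_const card_ord mulr_natr.
  rewrite ler_wpM2l ?(ltW lams0)//; apply: le_trans (mean_norm P bgam) _.
  rewrite -[leRHS](mean_cst P); apply: mean_le => //.
    exact: bounded_mfun_norm.
  exact: bounded_mfun_cst.
have -> : \sum_c clock_rate c * h * expR (- (total_rate * h)) * mean P (jump_effect g gam s c)
    = h * expR (- (total_rate * h)) * (N%:R * Dr).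
  by rewrite -sumE mulr_sumr; apply: eq_bigr => c _; ring.
have := mean_multiple_ticks s0 sh; rewrite addrAC subrr add0r => hbad.
have e0 := expR_ge1Dx (- (total_rate * h)).
have x0 : 0 <= total_rate * h by exact: mulr_ge0 (ltW total_rate_gt0) (ltW h0).
have e1 : expR (- (total_rate * h)) <= 1.
  apply: (@le_trans _ _ (expR 0)); last by rewrite expR0.
  by rewrite ler_expR oppr_le0.
set ee := expR _ in e0 e1 *.
have -> : N%:R^-1 * (h * ee * (N%:R * Dr)) = h * ee * Dr.
  by field; rewrite gt_eqF.
have a1 : 2 * M * mean P (multiple_ticks s (s + h)) <= 2 * M * (total_rate * h) ^+ 2.
  by rewrite ler_wpM2l// mulr_ge0.
have a2 : h * (1 - ee) * Dr <= h * (total_rate * h) * Q.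
  apply: le_trans (ler_norm _) _.
  have ee0 : 0 <= 1 - ee by lra.
  rewrite normrM normrM (gtr0_norm h0) (ger0_norm ee0).
  apply: ler_pM => //; first by rewrite mulr_ge0// ltW.
  by rewrite ler_wpM2l ?(ltW h0)//; lra.
by lra.
Qed.

(** During [t, t + h] the drift is at least its value at [t] minus a multiple of the
activity, whose mean is at most [(lam + mu + lams) * h]. *)
Lemma queue_avg_growth (g : nat -> R) n (M kap Gam B t h : R) gam :
  0 <= M -> 0 <= Gam -> 0 <= kap ->
  (forall v, `|g v| <= M) -> (forall v, (n <= v)%N -> g v = g n) ->
  (forall x y, `|generator g x - generator g y| <= kap) ->
  0 <= t -> 0 <= h ->
  (forall r, t <= r -> r <= t + h ->
    [/\ adapted_simple (F r) (gam r), forall w, `|gam r w| <= Gam,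
      forall w j, (forall i, (X r w j <= X r w i)%N) ->
       gam r w <= g (X r w j).+1 - g (X r w j) &
      B <= mean P (gam r)]) ->
  h * (mean P (queue_avg (generator g) t) + lams * B) - kap * (lam + mu + lams) * h ^+ 2
    <= mean P (queue_avg g (t + h)) - mean P (queue_avg g t).
Proof.
move=> M0 Gam0 kap0 gM gn genk t0 h0 hgam.
have [K K0 hK] := one_step_mean M0 Gam0 gM gn.
have gen_bd : exists M', forall v, `|generator g v| <= M'.
  exists (`|generator g 0%N| + kap) => v.
  have := genk v 0%N; have := ler_distD (generator g 0%N) (generator g v) 0.
  by rewrite !subr0; lra.
have [M' hM'] := gen_bd.
pose D := mean P (queue_avg (generator g) t) + lams * B - kap * (lam + mu + lams) * h.
have := @euler_le R (fun r => - mean P (queue_avg g r)) t h (- D) K 1 h0 ltr01.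
suff step : forall r q, t <= r -> r + q <= t + h -> 0 < q -> q <= 1 ->
    - mean P (queue_avg g (r + q)) <= - mean P (queue_avg g r) + q * - D + K * q ^+ 2.
  by move=> /(_ step); rewrite /D; lra.
move=> r q tr rq q0 _; have r0 : 0 <= r by exact: le_trans tr.
have rth : r <= t + h by lra.
have [sg gb gg hB] := hgam r tr rth.
have := hK r q (gam r) r0 q0 sg gb gg.
have b1 := bounded_queue_avg t0 hM'; have b2 := bounded_queue_avg r0 hM'.
have bact := bounded_activity t0 tr.
have : `|mean P (queue_avg (generator g) r) - mean P (queue_avg (generator g) t)| <=
    kap * ((r - t) * (lam + mu + lams)).
  rewrite -meanB//; apply: le_trans (mean_norm P _) _; first exact: bounded_mfunB.
  apply: le_trans (ler_wpM2l kap0 (activity_mean t0 tr)).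
  rewrite -meanZ//; apply: mean_le.
  - by apply: bounded_mfun_norm; exact: bounded_mfunB.
  - exact: bounded_mfunZ.
  - by move=> w; exact: queue_avg_change.
rewrite ler_norml => /andP[lo _].
have kc : kap * ((r - t) * (lam + mu + lams)) <= kap * (lam + mu + lams) * h.
  rewrite -mulrA ler_wpM2l// mulrC ler_wpM2l//; last by lra.
  by rewrite !addr_ge0// ltW.
have lb := ler_wpM2l (ltW lams0) hB.
have : D <= mean P (queue_avg (generator g) r) + lams * mean P (gam r) by rewrite /D; lra.
move=> /(ler_wpM2l (ltW q0)); lra.
Qed.

End Queues.

(** * Expected proportions of long queues *)

Section TailMeans.
Context {R : realType} (lam lams mu : R) (N : nat) (d : measure_display)
  (T : measurableType d) (P : probability T R) (F : R -> set (set T))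
  (A S : 'I_N -> R -> T -> nat) (G : R -> T -> nat) (X : R -> T -> 'I_N -> nat).
Hypothesis lam0 : 0 < lam.
Hypothesis lams0 : 0 < lams.
Hypothesis mu0 : 0 < mu.
Hypothesis N0 : (0 < N)%N.
Hypothesis HQ : driven_queues lam lams mu P F A S G X.

Implicit Types (a e h r t M : R) (g : nat -> R).

Definition at_least (k x : nat) : R := (k <= x)%:R.
Definition mean_tail (k : nat) (t : R) : R := mean P (queue_avg X (at_least k) t).

Let NR0 : 0 < N%:R :> R. Proof. by rewrite ltr0n. Qed.
Let c := lam + mu + lams.
Let c0 : 0 < c. Proof. by rewrite !addr_gt0. Qed.
Let growth := @queue_avg_growth R lam lams mu N d T P F A S G X lam0 lams0 mu0 N0 HQ.
Let act_mean := @activity_mean R lam lams mu N d T P F A S G X lam0 lams0 mu0 N0 HQ.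
Let bact := @bounded_activity R lam lams mu N d T P F A S G X HQ.
Let bavg := @bounded_queue_avg R lam lams mu N d T P F A S G X HQ.

Lemma at_least_le1 k x : `|at_least k x| <= 1.
Proof. by rewrite /at_least; case: (k <= x)%N; rewrite ?normr1 ?normr0. Qed.

Lemma bounded_tail k t : 0 <= t -> bounded_mfun (queue_avg X (at_least k) t).
Proof. by move=> t0; apply: (bavg (M := 1)) => // n; exact: at_least_le1. Qed.

Lemma queue_avgD (g1 g2 : nat -> R) t : queue_avg X (fun x => g1 x + g2 x) t =
  (fun w => queue_avg X g1 t w + queue_avg X g2 t w).
Proof. by apply/funext => w; rewrite /queue_avg big_split mulrDl. Qed.

Lemma queue_avgZ a (g : nat -> R) t : queue_avg X (fun x => a * g x) t =
  (fun w => a * queue_avg X g t w).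
Proof. by apply/funext => w; rewrite /queue_avg -mulr_sumr mulrA. Qed.

Lemma mean_queue_avgD (g1 g2 : nat -> R) M1 M2 t : 0 <= t ->
  (forall n, `|g1 n| <= M1) -> (forall n, `|g2 n| <= M2) ->
  mean P (queue_avg X (fun x => g1 x + g2 x) t) = mean P (queue_avg X g1 t) + mean P (queue_avg X g2 t).
Proof.
by move=> t0 h1 h2; rewrite queue_avgD meanD//; [exact: (bavg (M := M1))|exact: (bavg (M := M2))].
Qed.

Lemma mean_queue_avgZ a (g : nat -> R) M t : 0 <= t -> (forall n, `|g n| <= M) ->
  mean P (queue_avg X (fun x => a * g x) t) = a * mean P (queue_avg X g t).
Proof. by move=> t0 h; rewrite queue_avgZ meanZ//; exact: (bavg (M := M)). Qed.

Lemma mean_tail_comb (a0 a1 a2 a3 : R) i0 i1 i2 i3 t : 0 <= t ->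
  mean P (queue_avg X (fun x => a0 * at_least i0 x + a1 * at_least i1 x
     + a2 * at_least i2 x + a3 * at_least i3 x) t) =
  a0 * mean_tail i0 t + a1 * mean_tail i1 t + a2 * mean_tail i2 t + a3 * mean_tail i3 t.
Proof.
move=> t0.
have b a i n : `|a * at_least i n| <= `|a|.
  by rewrite normrM ler_piMr// at_least_le1.
have tl a i : mean P (queue_avg X (fun x => a * at_least i x) t) = a * mean_tail i t.
  by apply: (@mean_queue_avgZ _ _ 1) => // n; exact: at_least_le1.
have b2 n : `|a0 * at_least i0 n + a1 * at_least i1 n| <= `|a0| + `|a1|.
  by apply: le_trans (ler_normD _ _) _; rewrite lerD.
rewrite (@mean_queue_avgD _ _ (`|a0| + `|a1| + `|a2|) `|a3|)//; last first.
  by move=> n; apply: le_trans (ler_normD _ _) _; rewrite lerD.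
rewrite (@mean_queue_avgD _ _ (`|a0| + `|a1|) `|a2|)// (@mean_queue_avgD _ _ `|a0| `|a1|)//.
by rewrite !tl.
Qed.

Lemma mean_tail0 t : mean_tail 0 t = 1.
Proof.
rewrite /mean_tail -[RHS](mean_cst P); congr mean; apply/funext => w.
by rewrite /queue_avg sumr_const card_ord divff// gt_eqF.
Qed.

Lemma mean_tail_ge0 k t : 0 <= mean_tail k t.
Proof. by apply: mean_ge0 => w; rewrite divr_ge0// sumr_ge0. Qed.

Lemma mean_queue_avg_lipschitz (g : nat -> R) M t h : 0 <= t -> 0 <= h ->
  (forall n, `|g n| <= M) ->
  (forall x y, `|g x - g y| <= 1) ->
  `|mean P (queue_avg X g (t + h)) - mean P (queue_avg X g t)| <= c * h.
Proof.
move=> t0 h0 gM g1; have th : t <= t + h by rewrite lerDl.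
have th0 := le_trans t0 th.
rewrite -meanB; [|exact: (bavg (M := M))|exact: (bavg (M := M))].
have bd : bounded_mfun (fun w => queue_avg X g (t + h) w - queue_avg X g t w).
  by apply: bounded_mfunB; exact: (bavg (M := M)).
apply: le_trans (mean_norm P bd) _.
have := act_mean t0 th; rewrite addrAC subrr add0r mulrC; apply: le_trans.
apply: mean_le; [exact: bounded_mfun_norm|exact: bact|] => w.
by rewrite -[leRHS]mul1r; apply: (queue_avg_change N0 HQ).
Qed.

Lemma mean_tail_lipschitz k t h : 0 <= t -> 0 <= h ->
  `|mean_tail k (t + h) - mean_tail k t| <= c * h.
Proof.
move=> t0 h0; apply: (@mean_queue_avg_lipschitz _ 1) => // [n|x y]; first exact: at_least_le1.
rewrite /at_least; case: (k <= x)%N; case: (k <= y)%N;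
  by rewrite ?subrr ?sub0r ?subr0 ?normrN ?normr0 ?normr1.
Qed.

(** The last summand brings the expression into the form of [mean_tail_comb]. *)
Lemma generator_at_least k x : generator lam mu (at_least k.+1) x =
  lam * at_least k x + (- (lam + mu)) * at_least k.+1 x
  + mu * at_least k.+2 x + 0 * at_least 0 x.
Proof.
have -> : generator lam mu (at_least k.+1) x =
  lam * (at_least k x - at_least k.+1 x) + mu * (at_least k.+2 x - at_least k.+1 x).
  by rewrite /generator /at_least; case: x.
ring.
Qed.

Lemma generator_diff (g : nat -> R) x y : (forall n, `|g n.+1 - g n| <= 1) ->
  `|generator lam mu g x - generator lam mu g y| <= 2 * (lam + mu).
Proof.
move=> g1.
have gp n : `|g n.-1 - g n| <= 1.
  by case: n => [|n]; [rewrite subrr normr0|rewrite distrC].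
have b n : `|generator lam mu g n| <= lam + mu.
  apply: le_trans (ler_normD _ _) _; rewrite !normrM (gtr0_norm lam0) (gtr0_norm mu0).
  by rewrite lerD// ler_piMr// ltW.
by apply: le_trans (ler_normB _ _) _; have := b x; have := b y; lra.
Qed.

Lemma at_least_step k n : `|at_least k n.+1 - at_least k n| <= 1.
Proof.
rewrite /at_least; case: (k <= n.+1)%N; case: (k <= n)%N;
  by rewrite ?subrr ?sub0r ?subr0 ?normrN ?normr0 ?normr1.
Qed.

Lemma adapted_simple_cst r a : 0 <= r -> adapted_simple (F r) (fun=> a).
Proof.
move=> r0; have -> : (fun=> a) = (fun w : T => a * (\1_setT w)).
  by apply/funext => w; rewrite indicT mulr1.
by apply: adapted_simple_indic; exact: (F_setT HQ).
Qed.

Let C := 2 * (lam + mu) * c.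

Lemma lam_mu_ge0 : 0 <= 2 * (lam + mu).
Proof. by rewrite mulr_ge0// addr_ge0// ltW. Qed.

(** Shared customers never decrease a tail: take [gam = 0]. *)
Lemma mean_tail_drift_ge k t h : 0 <= t -> 0 <= h ->
  h * (lam * (mean_tail k t - mean_tail k.+1 t)
       - mu * (mean_tail k.+1 t - mean_tail k.+2 t)) - C * h ^+ 2
  <= mean_tail k.+1 (t + h) - mean_tail k.+1 t.
Proof.
move=> t0 h0.
have := @growth (at_least k.+1) k.+1 1 (2 * (lam + mu)) 0 0 t h (fun _ _ => 0)
  ler01 (lexx 0) lam_mu_ge0 (at_least_le1 k.+1).
have -> : queue_avg X (generator lam mu (at_least k.+1)) t =
   queue_avg X (fun x => lam * at_least k x + (- (lam + mu)) * at_least k.+1 x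
  + mu * at_least k.+2 x + 0 * at_least 0 x) t.
  by congr (queue_avg X _ t); apply/funext => x; exact: generator_at_least.
rewrite mean_tail_comb// => H.
have H2 : h * (lam * mean_tail k t + - (lam + mu) * mean_tail k.+1 t +
    mu * mean_tail k.+2 t + 0 * mean_tail 0 t + lams * 0) - C * h ^+ 2 <=
    mean_tail k.+1 (t + h) - mean_tail k.+1 t.
  apply: H => //.
  - by move=> v kv; rewrite /at_least leqnn kv.
  - by move=> x y; apply: generator_diff => n; exact: at_least_step.
  - move=> r tr rh; split => //.
    + by apply: adapted_simple_cst; exact: le_trans tr.
    + by move=> w; rewrite normr0.
    + by move=> w j _; rewrite subr_ge0 ler_nat /=; case: (ltnP k (X r w j)) => // /leqW ->.
    + by rewrite mean_cst.
by lra.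
Qed.

(** The length of a queue truncated at [n]; it averages to the sum of the first [n]
tails. *)
Definition capped (n x : nat) : R := \sum_(k < n) at_least k.+1 x.

Lemma cappedE n x : capped n x = (minn x n)%:R.
Proof.
elim: n => [|n IH]; first by rewrite /capped big_ord0 minn0.
rewrite /capped big_ord_recr /= -/(capped n x) IH /at_least -natrD; congr _%:R.
by case: (ltnP n x) => h; lia.
Qed.

Lemma mean_capped n t : 0 <= t ->
  mean P (queue_avg X (fun x => - capped n x) t) = - \sum_(k < n) mean_tail k.+1 t.
Proof.
move=> t0.
have -> : queue_avg X (fun x => - capped n x) t =
    (fun w => (-1) * \sum_(k < n) queue_avg X (at_least k.+1) t w).
  apply/funext => w; rewrite /queue_avg -mulr_suml mulrA; congr (_ / _).
  by rewrite /capped sumrN exchange_big mulN1r.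
rewrite meanZ ?mean_sum ?mulN1r//; first by move=> k; exact: bounded_tail.
by apply: bounded_mfun_sum => k; exact: bounded_tail.
Qed.

(** A shared customer raises the truncated length by at most 1. Applying
[queue_avg_growth] to the negative of that length gives the upper bound. *)
Lemma mean_tail_drift_sum n t h : 0 <= t -> 0 <= h ->
  \sum_(k < n) (mean_tail k.+1 (t + h) - mean_tail k.+1 t) <=
  h * (lam * (1 - mean_tail n t) - mu * (mean_tail 1 t - mean_tail n.+1 t) + lams)
  + C * h ^+ 2.
Proof.
move=> t0 h0; have th0 : 0 <= t + h by rewrite addr_ge0.
have step x : `|- capped n x.+1 - - capped n x| <= 1.
  rewrite -opprD normrN !cappedE.
  have -> : (minn x.+1 n)%:R - (minn x n)%:R = (x < n)%:R :> R.
    by rewrite -natrB; [congr _%:R|]; lia.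
  by case: (x < n)%N; rewrite ?normr1 ?normr0.
have := @growth (fun x => - capped n x) n n%:R (2 * (lam + mu)) 1 (-1) t h (fun _ _ => -1)
  (ler0n _ _) ler01 lam_mu_ge0.
have -> : queue_avg X (generator lam mu (fun x => - capped n x)) t =
   queue_avg X (fun x => (- lam) * at_least 0 x + lam * at_least n x
  + mu * at_least 1 x + (- mu) * at_least n.+1 x) t.
  congr (queue_avg X _ t); apply/funext => x; rewrite /generator !cappedE /at_least.
  have -> : (minn x.+1 n)%:R = (minn x n)%:R + 1 - (n <= x)%:R :> R.
    by apply: (canRL (addrK _)); rewrite natr1 -!natrD; congr _%:R; lia.
  have -> : (minn x.-1 n)%:R = (minn x n)%:R + (n.+1 <= x)%:R - (1 <= x)%:R :> R.
    by apply: (canRL (addrK _)); rewrite -!natrD; congr _%:R; lia.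
  by rewrite (_ : (0 <= x)%:R = 1 :> R)//; ring.
rewrite mean_tail_comb// !mean_capped// mean_tail0 => H.
have : h * (- lam * 1 + lam * mean_tail n t + mu * mean_tail 1 t
     + - mu * mean_tail n.+1 t + lams * -1) - C * h ^+ 2 <=
  - (\sum_(k < n) mean_tail k.+1 (t + h)) - - (\sum_(k < n) mean_tail k.+1 t).
  apply: H => //.
  - by move=> v; rewrite normrN cappedE normr_nat ler_nat; lia.
  - by move=> v nv; rewrite !cappedE; congr (- _%:R); lia.
  - by move=> x y; exact: generator_diff.
  - move=> r tr rh; split => //.
    + by apply: adapted_simple_cst; exact: le_trans tr.
    + by move=> w; rewrite normrN normr1.
    + by move=> w j _; have := step (X r w j); rewrite ler_norml => /andP[].
    + by rewrite mean_cst.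
rewrite sumrB; lra.
Qed.

Definition exactly (k x : nat) : R := (x == k)%:R.

Lemma exactly_le1 k x : `|exactly k x| <= 1.
Proof. by rewrite /exactly; case: (x == k); rewrite ?normr1 ?normr0. Qed.

Lemma exactly_diff k x y : `|exactly k x - exactly k y| <= 1.
Proof.
rewrite /exactly; case: (x == k); case: (y == k);
  by rewrite ?subrr ?sub0r ?subr0 ?normrN ?normr0 ?normr1.
Qed.

Lemma F_setU r B1 B2 : 0 <= r -> F r B1 -> F r B2 -> F r (B1 `|` B2).
Proof.
move=> r0 F1 F2; have [[F0 _ FU] _] := filtration_sigma_algebra HQ r0.
by rewrite -bigcup2E; apply: FU => -[|[|n]].
Qed.

Lemma F_some_empty r : 0 <= r -> F r [set w | exists i, X r w i = 0%N].
Proof.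
move=> r0.
suff H : forall s : seq 'I_N, F r [set w | exists2 i, i \in s & X r w i = 0%N].
  rewrite (_ : [set w | _] = [set w | exists2 i, i \in enum 'I_N & X r w i = 0%N])//.
  apply/seteqP; split => w [i]; first by exists i; rewrite ?mem_enum.
  by move=> _ ?; exists i.
elim=> [|i s IH].
  rewrite (_ : [set w | _] = set0); first exact: (F_set0 HQ).
  by apply/seteqP; split => // w [].
rewrite (_ : [set w | _] = [set w | X r w i = 0%N] `|`
  [set w | exists2 i, i \in s & X r w i = 0%N]).
  by apply: F_setU => //; exact: (queues_adapted HQ).
apply/seteqP; split => w /=.
  by move=> [j]; rewrite inE => /orP[/eqP -> ?|js ?]; [left|right; exists j].
by move=> [?|[j js ?]]; [exists i; rewrite ?mem_head|exists j; rewrite ?inE ?js ?orbT].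
Qed.

(** If no queue is empty at time [r], the proportion of empty queues has fallen to 0
from a value close to [a]; the activity since [t] or the deviation from [a] at
[t] accounts for it. *)
Lemma some_empty_mean a e t r : 0 < a -> 0 <= t -> t <= r ->
  mean P (fun w => `|queue_avg X (exactly 0) t w - a|) <= e ->
  1 - (e + c * (r - t)) / a <= mean P (\1_[set w | exists i, X r w i = 0%N]).
Proof.
move=> a0 t0 tr he; have r0 := le_trans t0 tr.
have be s (s0 : 0 <= s) : bounded_mfun (queue_avg X (exactly 0) s).
  by apply: (bavg (M := 1)) => // n; exact: exactly_le1.
have bn : bounded_mfun (fun w => `|queue_avg X (exactly 0) t w - a|).
  by apply: bounded_mfun_norm; apply: bounded_mfunB; [exact: be|exact: bounded_mfun_cst].
have bi : bounded_mfun (\1_[set w | exists i, X r w i = 0%N] : T -> R).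
  by apply: bounded_mfun_indic; apply: (F_measurable HQ r0); exact: F_some_empty.
have ba := bact t0 tr.
apply: (@le_trans _ _ (mean P (fun w => 1 - a^-1 *
    (`|queue_avg X (exactly 0) t w - a| + activity A S G t r w)))).
  rewrite meanB; [|exact: bounded_mfun_cst|by apply: bounded_mfunZ; exact: bounded_mfunD].
  rewrite mean_cst meanZ; last exact: bounded_mfunD.
  rewrite meanD// lerD2l lerN2 mulrC ler_wpM2r ?invr_ge0 ?(ltW a0)// lerD//.
  by rewrite mulrC; exact: act_mean.
apply: mean_le => //.
  apply: bounded_mfunB; first exact: bounded_mfun_cst.
  by apply: bounded_mfunZ; exact: bounded_mfunD.
move=> w.
have act1 := activity_ge0 A S G t r w.
have [[i Xi]|nE] := pselect (exists i, X r w i = 0%N).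
  rewrite indicE mem_set//=; last by exists i.
  have : 0 <= a^-1 * (`|queue_avg X (exactly 0) t w - a| + activity A S G t r w).
    by rewrite mulr_ge0 ?invr_ge0 ?(ltW a0)// addr_ge0.
  lra.
rewrite indicE memNset//= subr_le0 mulrC ler_pdivlMr// mul1r.
have o0 : queue_avg X (exactly 0) r w = 0.
  rewrite /queue_avg big1 ?mul0r// => i _; rewrite /exactly.
  by case: eqP => // Xi; case: nE; exists i.
have := @queue_avg_change R lam lams mu N d T P F A S G X N0 HQ (exactly 0) 1 t r w ler01
  (exactly_diff 0) t0 tr; rewrite o0 sub0r normrN mul1r => o1.
have := ler_norm (queue_avg X (exactly 0) t w).
have := ler_norm (- (queue_avg X (exactly 0) t w - a)); rewrite normrN; lra.
Qed.

(** While some queue is empty, each shared customer fills one: take for [gam] the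
indicator of that event. *)
Lemma mean_tail_drift1_ge a e t h : 0 < a -> 0 <= t -> 0 <= h ->
  mean P (fun w => `|queue_avg X (exactly 0) t w - a|) <= e ->
  h * (lam * (1 - mean_tail 1 t) - mu * (mean_tail 1 t - mean_tail 2 t)
       + lams * (1 - (e + c * h) / a)) - C * h ^+ 2
  <= mean_tail 1 (t + h) - mean_tail 1 t.
Proof.
move=> a0 t0 h0 he.
have := @growth (at_least 1) 1 1 (2 * (lam + mu)) 1 (1 - (e + c * h) / a) t h
  (fun r => \1_[set w | exists i, X r w i = 0%N])
  ler01 ler01 lam_mu_ge0 (at_least_le1 1).
have -> : queue_avg X (generator lam mu (at_least 1)) t =
   queue_avg X (fun x => lam * at_least 0 x + (- (lam + mu)) * at_least 1 x
  + mu * at_least 2 x + 0 * at_least 0 x) t.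
  by congr (queue_avg X _ t); apply/funext => x; exact: generator_at_least.
rewrite mean_tail_comb// mean_tail0 => H.
have : h * (lam * 1 + - (lam + mu) * mean_tail 1 t +
    mu * mean_tail 2 t + 0 * 1 + lams * (1 - (e + c * h) / a)) - C * h ^+ 2 <=
    mean_tail 1 (t + h) - mean_tail 1 t.
  apply: H => //.
  - by move=> v kv; rewrite /at_least leqnn kv.
  - by move=> x y; apply: generator_diff => n; exact: at_least_step.
  - move=> r tr rh; have r0 := le_trans t0 tr; split => //.
    + have -> : (\1_[set w | exists i, X r w i = 0%N] : T -> R) =
         (fun w => 1 * \1_[set w | exists i, X r w i = 0%N] w).
        by apply/funext => w; rewrite mul1r.
      by apply: adapted_simple_indic; exact: F_some_empty.
    + by move=> w; rewrite indicE; case: (_ \in _); rewrite ?normr1 ?normr0.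
    + move=> w j hj; rewrite indicE.
      have [/set_mem/=[i Xi]|_] := boolP (w \in _).
        have -> : X r w j = 0%N by apply/eqP; rewrite -leqn0 -Xi.
        by rewrite /at_least /= subr0.
      by rewrite subr_ge0 ler_nat /=; case: (X r w j).
    + apply: le_trans (some_empty_mean a0 t0 tr he).
      rewrite lerD2l lerN2 ler_wpM2r ?invr_ge0 ?(ltW a0)// lerD2l.
      by rewrite ler_wpM2l ?(ltW c0)//; lra.
by lra.
Qed.

End TailMeans.

(** * A Skorokhod continuous test function *)

Section Bump.
Context {R : realType} (K t0 a : R) (k : nat).
Hypothesis K0 : 0 < K.
Hypothesis t00 : 0 <= t0.

(** A tent of slope [K] around the point [(t0, a)], evaluated on the graph of the k-th
coordinate of [x]. *)
Definition bump (x : R -> nat -> R) (s : R) : R :=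
  Num.max 0 (1 - K * `|s - t0| - K * `|x s k - a|).

(** Taking the supremum over the whole graph makes the value insensitive to small
changes of time, hence Skorokhod continuous even at paths that jump at [t0]. *)
Definition graph_bump (x : R -> nat -> R) : R :=
  sup [set bump x s | s in [set s | 0 <= s]].

Implicit Types x y : R -> nat -> R.

Lemma bump_le1 x s : bump x s <= 1.
Proof.
have h1 : 0 <= K * `|s - t0| by rewrite mulr_ge0// ltW.
have h2 : 0 <= K * `|x s k - a| by rewrite mulr_ge0// ltW.
by rewrite ge_max ler01 /=; lra.
Qed.

Lemma bump_ge0 x s : 0 <= bump x s.
Proof. by rewrite le_max lexx. Qed.

Lemma bump_sup x : has_sup [set bump x s | s in [set s | 0 <= s]].
Proof.
split; first by exists (bump x 0); exists 0 => //=.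
by exists 1 => _ [s _ <-]; exact: bump_le1.
Qed.

Lemma le_graph_bump x s : 0 <= s -> bump x s <= graph_bump x.
Proof. by move=> s0; apply: sup_upper_bound; [exact: bump_sup|exists s]. Qed.

Lemma graph_bump_ge0 x : 0 <= graph_bump x.
Proof. by apply: le_trans (le_graph_bump x (lexx 0)); exact: bump_ge0. Qed.

Lemma graph_bump_le x b : (forall s, 0 <= s -> bump x s <= b) -> graph_bump x <= b.
Proof.
move=> h; apply: ge_sup; first by exists (bump x 0); exists 0 => //=.
by move=> _ [s s0 <-]; exact: h.
Qed.

Lemma graph_bump_le1 x : graph_bump x <= 1.
Proof. by apply: graph_bump_le => s _; exact: bump_le1. Qed.

Lemma graph_bump_on_graph x : x t0 k = a -> graph_bump x = 1.
Proof.
move=> xa; apply/eqP; rewrite eq_le graph_bump_le1 /=.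
have := le_graph_bump x t00; rewrite /bump xa !subrr normr0 !mulr0 !subr0.
by rewrite (max_idPr _).
Qed.

Lemma graph_bump_gt0 x : 0 < graph_bump x ->
  exists s, [/\ 0 <= s, K * `|s - t0| < 1 & K * `|x s k - a| < 1].
Proof.
move=> gt0; have [_ [s /= s0 <-]] := sup_adherent gt0 (bump_sup x).
rewrite subrr /bump lt_max ltxx /= => b; exists s.
have h1 : 0 <= K * `|s - t0| by rewrite mulr_ge0// ltW.
have h2 : 0 <= K * `|x s k - a| by rewrite mulr_ge0// ltW.
by split=> //; lra.
Qed.

Lemma bump_near x y s r e : `|s - r| <= e -> `|x s k - y r k| <= e ->
  bump x s <= bump y r + 2 * K * e.
Proof.
move=> sr xy; have e0 : 0 <= e by exact: le_trans sr.
have Ke : 0 <= 2 * K * e by rewrite mulr_ge0// mulr_ge0// ltW.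
rewrite /bump ge_max; apply/andP; split.
  by rewrite addr_ge0// le_max lexx.
have h1 : K * `|r - t0| <= K * `|s - t0| + K * e.
  rewrite -mulrDr ler_wpM2l ?(ltW K0)//.
  by have := ler_distD s r t0; rewrite [`|r - s|]distrC; lra.
have h2 : K * `|y r k - a| <= K * `|x s k - a| + K * e.
  rewrite -mulrDr ler_wpM2l ?(ltW K0)//.
  by have := ler_distD (x s k) (y r k) a; rewrite [`|y r k - x s k|]distrC; lra.
have : 1 - K * `|r - t0| - K * `|y r k - a| <=
  Num.max 0 (1 - K * `|r - t0| - K * `|y r k - a|) by rewrite le_max lexx orbT.
lra.
Qed.

Lemma bump_out x s : t0 + K^-1 <= s -> bump x s = 0.
Proof.
move=> h; rewrite /bump (max_idPl _)//.
have : 1 <= K * `|s - t0|.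
  rewrite -[leLHS](divff (lt0r_neq0 K0)) ler_wpM2l ?(ltW K0)//.
  by apply: le_trans (ler_norm _); lra.
have h2 : 0 <= K * `|x s k - a| by rewrite mulr_ge0// ltW.
lra.
Qed.

(** The time changes match the points of both graphs up to distance [dl] before the time
[t0 + K^-1 + 1], and the tent vanishes after [t0 + K^-1]. *)
Lemma graph_bump_continuous : bounded_skorokhod_continuous graph_bump.
Proof.
split; first by exists 1 => x _; rewrite ger0_norm ?graph_bump_ge0// graph_bump_le1.
move=> x y _ _ [tau htau hxy]; apply/cvgrPdist_le => e e0.
pose dl := Num.min 1 (e / (2 * K)).
have K20 : 0 < 2 * K by rewrite mulr_gt0.
have dl0 : 0 < dl by rewrite lt_min ltr01 divr_gt0.
have dle : 2 * K * dl <= e by rewrite mulrC -ler_pdivlMr// ge_min lexx orbT.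
have dl1 : dl <= 1 by rewrite ge_min lexx.
have KV : 0 < K^-1 by rewrite invr_gt0.
have [h1 h2] := hxy (t0 + K^-1 + 1) dl dl0.
near=> n.
have /= tn : forall t, 0 <= t -> t <= t0 + K^-1 + 1 -> `|tau n t - t| < dl by near: n.
have /= xn : forall t, 0 <= t -> t <= t0 + K^-1 + 1 ->
  `|x n t k - y (tau n t) k| < dl by near: n; exact: h2.
have [[tau1 tau2 tau3] tau4] := htau n.
rewrite ler_distl; apply/andP; split.
  suff : graph_bump (x n) <= graph_bump y + e by lra.
  apply: graph_bump_le => s s0.
  have [sout|sin] := leP (t0 + K^-1) s.
    by rewrite bump_out// addr_ge0// ?(ltW e0)// graph_bump_ge0.
  have sle : s <= t0 + K^-1 + 1 by lra.
  apply: (@le_trans _ _ (bump y (tau n s) + 2 * K * dl)).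
    apply: bump_near; last by apply: ltW; exact: xn.
    by rewrite distrC; apply: ltW; exact: tn.
  by rewrite lerD// le_graph_bump//; apply: tau1.
apply: graph_bump_le => r r0.
have [rout|rin] := leP (t0 + K^-1) r.
  by rewrite bump_out// addr_ge0// ?(ltW e0)// graph_bump_ge0.
have [s /= s0 sr] := tau3 r r0.
have sle : s <= t0 + K^-1 + 1.
  rewrite leNgt; apply/negP => hs.
  have c0 : 0 <= t0 + K^-1 + 1 by lra.
  have := tau4 _ _ c0 hs; rewrite sr.
  have := tn _ c0 (lexx _); rewrite ltr_norml => /andP[]; lra.
apply: (@le_trans _ _ (bump (x n) s + 2 * K * dl)).
  rewrite -sr; apply: bump_near; first by apply: ltW; exact: tn.
  by rewrite distrC; apply: ltW; exact: xn.
by rewrite lerD// le_graph_bump.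
Unshelve. all: by end_near. Qed.

End Bump.

Section LowerIntegral.
Import HBNNSimple.

(** A nonnegative function need not be measurable for its integral to be defined; the
integral is then a supremum over simple functions below it. So a lower bound on
the expectation passes to a measurable minorant, and the measurability of
[graph_bump] along the paths is not an issue. *)
Lemma lower_integral d (T : measurableType d) (R : realType) (P : probability T R)
    (f : T -> R) (b : R) : (forall w, 0 <= f w <= 1) -> (b%:E < 'E_P[f])%E ->
  exists h : T -> R, [/\ bounded_mfun h, forall w, 0 <= h w <= f w & b < mean P h].
Proof.
move=> f01; rewrite unlock ge0_integralTE; last first.
  by move=> w; rewrite lee_fin; have /andP[] := f01 w.
move=> /ereal_sup_gt[_ [h /= hf <-]] bh.
have hf' w : h w <= f w by rewrite -lee_fin.
have h0 w : 0 <= h w by exact: fun_ge0.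
have bdh : bounded_mfun h.
  split; first exact: measurable_funP.
  exists 1 => w; rewrite ger0_norm//; apply: le_trans (hf' w) _.
  by have /andP[] := f01 w.
exists h; split=> // [w|]; first by rewrite h0 hf'.
rewrite -lte_fin (lt_le_trans bh)// /mean /Rintegral fineK.
  by rewrite integral_nnsfun// patch_setT.
by apply: integrable_fin_num => //; exact: bounded_mfun_integrable.
Qed.

End LowerIntegral.

(** * The dynamics of the limit *)

Lemma is_state_le1 (R : realType) (x : nat -> R) k : is_state x -> x k <= 1.
Proof.
move=> [x0 xc].
have nd : nondecreasing_seq (fun n => \sum_(i < n) x i).
  apply/nondecreasing_seqP => n.
  by rewrite big_ord_recr /= lerDl.
have := nondecreasing_cvgn_le nd (cvgP _ xc) k.+1.
rewrite (cvg_lim _ xc)//; apply: le_trans.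
by rewrite big_ord_recr /= lerDr sumr_ge0.
Qed.

Lemma occupancyE (R : realType) (N : nat) d (T : measurableType d)
    (X : R -> T -> 'I_N -> nat) t w k :
  occupancy R (X t w) k = queue_avg X (exactly (R := R) k) t w.
Proof.
rewrite /occupancy /queue_avg /exactly; congr (_ / _).
by rewrite -sum1dep_card natr_sum big_mkcond /=; apply: eq_bigr => i _; case: eqP.
Qed.

Section MeanFieldLimit.
Context {R : realType} (lam lams mu : R).
Hypothesis lam0 : 0 < lam.
Hypothesis lams0 : 0 < lams.
Hypothesis mu0 : 0 < mu.
Context (d : nat -> measure_display) (T : forall n, measurableType (d n))
    (P : forall n, probability (T n) R)
    (X : forall n, R -> T n -> 'I_n.+1 -> nat) (u : R -> nat -> R).
Hypothesis jsq : forall n, jsq_system lam lams mu (P n) (@X n).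
Hypothesis wcv : weak_cvg_to_path P (fun n t w => occupancy R (@X n t w)) u.
Implicit Types (t h e : R) (k : nat).

Let c := lam + mu + lams.
Let c0 : 0 < c. Proof. by rewrite !addr_gt0. Qed.

Lemma limit_state t : 0 <= t -> is_state (u t).
Proof. by case: wcv => -[+ _ _] _; apply. Qed.

Let dev n k t : T n -> R := fun w => `|queue_avg (@X n) (exactly k) t w - u t k|.

(** If the tent around [(t, u t k)] is positive on a path, that path is within [eps] of
the limit at some time within [eps] of [t], and between the two times it moves at
most by the activity. The mean of the minorant [g] bounds the exceptional event. *)
Lemma occupancy_cvg_mean t k : 0 <= t ->
  mean (P n) (dev k t) @[n --> \oo] --> (0 : R).
Proof.
move=> t0; apply/cvgrPdist_le => e e0.
pose eps := e / (2 + 2 * c).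
have cc : 0 < 2 + 2 * c by rewrite addr_gt0// mulr_gt0.
have eps0 : 0 < eps by rewrite divr_gt0.
have epsE : 2 * eps + 2 * eps * c = e by rewrite /eps; field; rewrite gt_eqF.
have K0 : 0 < eps^-1 by rewrite invr_gt0.
have [ust1 ust2] := limit_state t0.
have ule1 : u t k <= 1 by apply: is_state_le1; exact: limit_state.
case: wcv => _ /(_ _ (graph_bump_continuous t (u t k) k K0)).
rewrite (graph_bump_on_graph K0 t0)// => /fine_cvgP[fin /cvgrPdist_lt /(_ _ eps0) near1].
near=> n.
have fin_n : 'E_(P n)[fun w => graph_bump eps^-1 t (u t k) k
   (fun s => occupancy R (@X n s w))]%E \is a fin_num by near: n.
have : `|1 - fine 'E_(P n)[fun w => graph_bump eps^-1 t (u t k) k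
   (fun s => occupancy R (@X n s w))]%E| < eps by near: n.
rewrite ltr_norml => /andP[_ lowE].
have lowE' : ((1 - eps)%:E < 'E_(P n)[fun w => graph_bump eps^-1 t (u t k) k
   (fun s => occupancy R (@X n s w))])%E.
  by rewrite -(fineK fin_n) lte_fin; lra.
have [|g [bg gf mg]] := lower_integral _ lowE'.
  by move=> w; rewrite graph_bump_ge0// graph_bump_le1.
have [F [A [S [G HQ]]]] := jsq n.
have nn : (0 < n.+1)%N by [].
pose t1 := Num.max 0 (t - eps); pose t2 := t + eps.
have t10 : 0 <= t1 by rewrite le_max lexx.
have t1t : t1 <= t by rewrite ge_max t0 /= lerBlDr lerDl ltW.
have tt2 : t <= t2 by rewrite lerDl ltW.
have t12 := le_trans t1t tt2.
have bo s (s0 : 0 <= s) : bounded_mfun (queue_avg (@X n) (exactly (R := R) k) s).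
  by apply: (bounded_queue_avg HQ (M := 1)) => // j; apply: exactly_le1.
have bdev : bounded_mfun (dev (n := n) k t).
  by apply: bounded_mfun_norm; apply: bounded_mfunB; [exact: bo|exact: bounded_mfun_cst].
have bact := bounded_activity HQ t10 t12.
have m0 : 0 <= mean (P n) (dev (n := n) k t) by apply: mean_ge0 => w; exact: normr_ge0.
rewrite sub0r normrN (ger0_norm m0).
apply: (@le_trans _ _ (mean (P n) (fun w => (eps + activity A S G t1 t2 w) + (1 - g w)))).
  apply: mean_le => //.
    apply: bounded_mfunD; first by apply: bounded_mfunD => //; exact: bounded_mfun_cst.
    by apply: bounded_mfunB => //; exact: bounded_mfun_cst.
  move=> w; have /andP[g0 gle] := gf w.
  have act0 := activity_ge0 A S G t1 t2 w.
  have [gb|gb] := leP (graph_bump eps^-1 t (u t k) k (fun s => occupancy R (@X n s w))) 0.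
    have ob : 0 <= queue_avg (@X n) (exactly (R := R) k) t w <= 1.
      rewrite /queue_avg divr_ge0 ?sumr_ge0//= ler_pdivrMr ?ltr0n// mul1r.
      apply: (@le_trans _ _ (\sum_(i < n.+1) 1)); last by rewrite sumr_const card_ord.
      by apply: ler_sum => i _; rewrite /exactly; case: eqP.
    have : dev (n := n) k t w <= 1.
      rewrite /dev ler_norml; have := ust1 k; move: ob => /andP[]; lra.
    lra.
  have [s [s0 st sx]] := graph_bump_gt0 K0 gb.
  have st' : `|s - t| < eps by rewrite mulrC ltr_pdivrMr// mul1r in st.
  have sx' : `|occupancy R (@X n s w) k - u t k| < eps.
    by rewrite mulrC ltr_pdivrMr// mul1r in sx.
  have gle1 : g w <= 1 by apply: le_trans gle _; exact: graph_bump_le1.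
  rewrite occupancyE in sx'.
  have osc : `|queue_avg (@X n) (exactly (R := R) k) t w - queue_avg (@X n) (exactly k) s w|
      <= activity A S G t1 t2 w.
    have t1s : t1 <= s by rewrite ge_max s0 /=; move: st'; rewrite ltr_norml => /andP[]; lra.
    have st2 : s <= t2 by move: st'; rewrite ltr_norml /t2 => /andP[]; lra.
    have [ts|ts] := leP t s.
      rewrite distrC; apply: (le_trans (queue_avg_change nn HQ w ler01 (@exactly_diff R k) t0 ts)).
      by rewrite mul1r; exact: (activity_mono HQ).
    apply: (le_trans (queue_avg_change nn HQ w ler01 (@exactly_diff R k) s0 (ltW ts))).
    by rewrite mul1r; apply: (activity_mono HQ) => //; exact: ltW.
  rewrite /dev.
  have := ler_distD (queue_avg (@X n) (exactly (R := R) k) s w)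
    (queue_avg (@X n) (exactly (R := R) k) t w) (u t k).
  lra.
rewrite meanD; last first.
- by apply: bounded_mfunB => //; exact: bounded_mfun_cst.
- by apply: bounded_mfunD => //; exact: bounded_mfun_cst.
rewrite meanD//; last exact: bounded_mfun_cst.
rewrite meanB//; last exact: bounded_mfun_cst.
rewrite !mean_cst.
have := activity_mean lam0 lams0 mu0 nn HQ t10 t12; rewrite -/c.
have : (t2 - t1) * c <= 2 * eps * c.
  rewrite ler_wpM2r ?(ltW c0)// /t2.
  have : t - eps <= t1 by rewrite le_max lexx orbT.
  lra.
lra.
Unshelve. all: by end_near. Qed.

End MeanFieldLimit.

Lemma mean_tailS (R : realType) (lam lams mu : R) (N : nat) d
  (T : measurableType d) (P : probability T R) F A S G (X : R -> T -> 'I_N -> nat)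
  (k : nat) (t : R) : driven_queues lam lams mu P F A S G X -> 0 <= t ->
  mean_tail P X k.+1 t = mean_tail P X k t - mean P (queue_avg X (exactly k) t).
Proof.
move=> HQ t0; apply/eqP; rewrite -subr_eq opprK; apply/eqP.
rewrite -(mean_queue_avgD HQ t0 (@at_least_le1 R k.+1) (@exactly_le1 R k)).
congr (mean P (queue_avg X _ t)); apply/funext => x; rewrite /at_least /exactly -natrD.
by congr _%:R; case: (ltngtP k x).
Qed.

Lemma cvg_le_forall (R : realType) (f g : nat -> R) (l l' : R) :
  f n @[n --> \oo] --> l -> g n @[n --> \oo] --> l' -> (forall n, f n <= g n) ->
  l <= l'.
Proof. by move=> fl gl fg; apply: (ler_cvg_to fl gl); exact: nearW. Qed.

Lemma cvg_drift (R : realType) (h a b r : R) (f1 f2 f3 f4 f5 : nat -> R)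
    (l1 l2 l3 l4 l5 : R) :
  f1 n @[n --> \oo] --> l1 -> f2 n @[n --> \oo] --> l2 ->
  f3 n @[n --> \oo] --> l3 -> f4 n @[n --> \oo] --> l4 ->
  f5 n @[n --> \oo] --> l5 ->
  h * (a * (f1 n - f2 n) - b * (f3 n - f4 n) + f5 n) + r @[n --> \oo] -->
  h * (a * (l1 - l2) - b * (l3 - l4) + l5) + r.
Proof.
move=> c1 c2 c3 c4 c5; apply: cvgD; last exact: cvg_cst.
apply: cvgM; first exact: cvg_cst.
apply: cvgD c5; apply: cvgB; apply: cvgM; try exact: cvg_cst; exact: cvgB.
Qed.

Section MeanFieldDynamics.
Context {R : realType} (lam lams mu : R).
Hypothesis lam0 : 0 < lam.
Hypothesis lams0 : 0 < lams.
Hypothesis mu0 : 0 < mu.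
Context (d : nat -> measure_display) (T : forall n, measurableType (d n))
    (P : forall n, probability (T n) R)
    (X : forall n, R -> T n -> 'I_n.+1 -> nat) (u : R -> nat -> R).
Hypothesis jsq : forall n, jsq_system lam lams mu (P n) (@X n).
Hypothesis wcv : weak_cvg_to_path P (fun n t w => occupancy R (@X n t w)) u.
Implicit Types (t h e : R) (k : nat).

Let c := lam + mu + lams.
Let c0 : 0 < c. Proof. by rewrite !addr_gt0. Qed.

Definition tail_of (k : nat) (t : R) : R := 1 - \sum_(j < k) u t j.

Lemma tail_ofS k t : tail_of k.+1 t = tail_of k t - u t k.
Proof. by rewrite /tail_of big_ord_recr /= opprD addrA. Qed.

Let m n k t := mean_tail (P n) (@X n) k t.

Lemma mean_occupancy_cvg t k : 0 <= t ->
  mean (P n) (queue_avg (@X n) (exactly k) t) @[n --> \oo] --> u t k.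
Proof.
move=> t0; apply/cvgrPdist_le => e e0.
have /cvgrPdist_le /(_ _ e0) H := occupancy_cvg_mean lam0 lams0 mu0 jsq wcv k t0.
apply: filterS H => n; rewrite sub0r normrN => H.
have [F [A [S [G HQ]]]] := jsq n.
have bo : bounded_mfun (queue_avg (@X n) (exactly (R := R) k) t).
  by apply: (bounded_queue_avg HQ (M := 1)) => // j; apply: exactly_le1.
have bc := bounded_mfun_cst (T n) (u t k).
rewrite distrC -[X in `|_ - X|](mean_cst (P n)) -meanB//.
apply: le_trans (mean_norm _ _) (le_trans (ler_norm _) H).
exact: bounded_mfunB.
Qed.

Lemma mean_tail_cvg t k : 0 <= t -> m n k t @[n --> \oo] --> tail_of k t.
Proof.
move=> t0; elim: k => [|k IH].
  rewrite /tail_of big_ord0 subr0 (_ : (fun n => _) = (fun=> 1)); first exact: cvg_cst.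
  by apply/funext => n; rewrite /m mean_tail0.
rewrite tail_ofS (_ : (fun n => _) =
  (fun n => m n k t - mean (P n) (queue_avg (@X n) (exactly k) t))).
  by apply: cvgB => //; exact: mean_occupancy_cvg.
apply/funext => n; have [F [A [S [G HQ]]]] := jsq n.
by rewrite /m (mean_tailS k HQ).
Qed.

Let C := 2 * (lam + mu) * c.
Let C0 : 0 <= C.
Proof. by rewrite mulr_ge0// ?(ltW c0)// mulr_ge0// addr_ge0// ltW. Qed.

(** Each bound holds in mean for every finite system, with constants that do not depend
on the number of queues, and passes to the limit. *)
Lemma limit_tail_dynamics : tail_dynamics lam lams mu tail_of.
Proof.
have cv k t (t0 : 0 <= t) := @mean_tail_cvg t k t0.
split.
- by move=> t _; rewrite /tail_of big_ord0 subr0.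
- move=> k t t0; apply: (cvg_le_forall (cvg_cst 0) (cv k t t0)) => n.
  exact: mean_tail_ge0.
- move=> k t t0; rewrite tail_ofS lerBlDr lerDl.
  by have [+ _] := limit_state wcv t0; apply.
- move=> t t0 e e0; have [_ /cvgrPdist_le /(_ _ e0)[n0 _ h]] := limit_state wcv t0.
  by exists n0 => n n0n; apply: le_trans (ler_norm _) (h n n0n).
- exists c => // k t h t0 h0; have th0 := addr_ge0 t0 h0.
  apply: (cvg_le_forall (cvg_norm (cvgB (cv k _ th0) (cv k _ t0))) (cvg_cst (c * h))) => n.
  have [F [A [S [G HQ]]]] := jsq n.
  exact: (mean_tail_lipschitz lam0 lams0 mu0 _ HQ).
- exists C => // k t h t0 h0; have th0 := addr_ge0 t0 h0.
  rewrite -[X in h * X]addr0.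
  apply: (@cvg_le_forall R (fun n => h * (lam * (m n k t - m n k.+1 t)
       - mu * (m n k.+1 t - m n k.+2 t) + 0) - C * h ^+ 2)
       (fun n => m n k.+1 (t + h) - m n k.+1 t)).
  + by apply: cvg_drift; try exact: cv; exact: cvg_cst.
  + by apply: cvgB; exact: cv.
  + move=> n; have [F [A [S [G HQ]]]] := jsq n.
    by rewrite addr0; exact: (mean_tail_drift_ge lam0 lams0 mu0 _ HQ).
- move=> N; exists C => // t h t0 h0; have th0 := addr_ge0 t0 h0.
  apply: (@cvg_le_forall R (fun n => \sum_(k < N) (m n k.+1 (t + h) - m n k.+1 t))
    (fun n => h * (lam * (1 - m n N t) - mu * (m n 1%N t - m n N.+1 t) + lams)
      + C * h ^+ 2)).
  + elim: N => [|N IH].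
      by under eq_fun do rewrite big_ord0; rewrite big_ord0; exact: cvg_cst.
    under eq_fun do rewrite big_ord_recr /=; rewrite big_ord_recr /=.
    by apply: cvgD => //; apply: cvgB; exact: cv.
  + by apply: cvg_drift; try exact: cv; exact: cvg_cst.
  + move=> n; have [F [A [S [G HQ]]]] := jsq n.
    exact: (mean_tail_drift_sum lam0 lams0 mu0 _ HQ).
- move=> eta eta0; exists (C + lams * (c / eta)).
    by rewrite addr_ge0// mulr_ge0 ?divr_ge0// ltW.
  move=> t h t0 h0 s1; have th0 := addr_ge0 t0 h0.
  have a_eta : eta <= u t 0%N.
    by move: s1; rewrite tail_ofS /tail_of big_ord0 subr0; lra.
  have a0 : 0 < u t 0%N by exact: lt_le_trans a_eta.
  pose ee n := mean (P n) (fun w => `|queue_avg (@X n) (exactly 0) t w - u t 0%N|).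
  have cve : ee n @[n --> \oo] --> (0 : R).
    exact: (occupancy_cvg_mean lam0 lams0 mu0 jsq wcv 0%N t0).
  apply: (@le_trans _ _ (h * (lam * (1 - tail_of 1 t) - mu * (tail_of 1 t - tail_of 2 t)
       + lams * (1 - (0 + c * h) * (u t 0%N)^-1)) - C * h ^+ 2)).
    have : (c * h) * (u t 0%N)^-1 <= (c * h) * eta^-1.
      rewrite ler_wpM2l ?lef_pV2 ?posrE// mulr_ge0// ltW//.
    move=> H.
    have := ler_wpM2l (mulr_ge0 h0 (ltW lams0)) H.
    rewrite add0r; lra.
  apply: (@cvg_le_forall R (fun n => h * (lam * (1 - m n 1%N t) - mu * (m n 1%N t - m n 2%N t)
       + lams * (1 - (ee n + c * h) * (u t 0%N)^-1)) - C * h ^+ 2)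
       (fun n => m n 1%N (t + h) - m n 1%N t)).
  + apply: cvg_drift; try exact: cv; first exact: cvg_cst.
    apply: cvgM; first exact: cvg_cst.
    apply: cvgB; first exact: cvg_cst.
    by apply: cvgM; [apply: cvgD; [exact: cve|exact: cvg_cst]|exact: cvg_cst].
  + by apply: cvgB; exact: cv.
  + move=> n; have [F [A [S [G HQ]]]] := jsq n.
    exact: (mean_tail_drift1_ge lam0 lams0 mu0 _ HQ).
Qed.

End MeanFieldDynamics.

Theorem theorem4p1 (R : realType) (lambda lambda_s mu : R)
    (lambda_gt0 : 0 < lambda) (lambda_s_gt0 : 0 < lambda_s) (mu_gt0 : 0 < mu)
    (stable : lambda + lambda_s < mu)
    (u0 : nat -> R) (u0_state : is_state u0)
    (u : R -> nat -> R)
    (u_traj : mean_field_trajectory lambda lambda_s mu u0 u) :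
  forall k : nat, u t k @[t --> +oo] --> fixed_point lambda lambda_s mu k.
Proof.
case: u_traj => d [T [P [X [v [jsq _ _ wcv]]]]] k.
have dyn := limit_tail_dynamics lambda_gt0 lambda_s_gt0 mu_gt0 jsq wcv.
apply/cvgrPdist_le => e e0.
have e20 : 0 < e / 2 by rewrite divr_gt0.
have [T1 T10 h1] := tail_cvg lambda_gt0 lambda_s_gt0 mu_gt0 stable dyn k e20.
have [T2 T20 h2] := tail_cvg lambda_gt0 lambda_s_gt0 mu_gt0 stable dyn k.+1 e20.
exists (T1 + T2); split; first exact: num_real.
move=> t Tt /=.
have -> : fixed_point lambda lambda_s mu k =
    tail_fixed lambda lambda_s mu k - tail_fixed lambda lambda_s mu k.+1.
  by case: k {h1 h2} => [|k] /=; rewrite /fixed_point /= ?expr0 ?mulr1// exprS; ring.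
have -> : u t k = tail_of u k t - tail_of u k.+1 t by rewrite tail_ofS; ring.
have t1 : T1 <= t by lra.
have t2 : T2 <= t by lra.
have := h1 t t1; have := h2 t t2.
rewrite !ler_norml => /andP[a b] /andP[a' b']; apply/andP; split; lra.
Qed.
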